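(* Let $m,n\ge1$ and let $\mathcal{C}$ be a simplicial complex on ground set $V$ obtained from $D_{m,n}$ (on vertex set $W\subseteq V$) by a finite sequence of operations, each of which is either $\operatorname{cone}^p(\cdot)$, $G(\cdot)$, or $\Lambda(\cdot)$. Call a vertex a Lawrence vertex if it is the new vertex added by one of the Lawrence liftings $\Lambda(\cdot)$ in this sequence. Let $\mathbf{d}=(d_v)_{v\in V}$ with all $d_v\ge 2$. Then $\mathcal{A}_{\mathcal{C},\mathbf{d}}$ is unimodular if and only if $d_v=2$ for every $v\in W$ and $d_v=2$ for every Lawrence vertex $v$.
   Context: A simplicial complex on a finite ground set $V$ is a family of subsets of $V$ closed under taking subsets; facets are inclusion-maximal faces. For $\mathbf{d}=(d_v)_{v\in V}$ with all $d_v\ge2$, $\mathcal{A}_{\mathcal{C},\mathbf{d}}$ is the $0/1$ matrix with columns indexed by $\mathbf{i}\in\prod_{v\in V}[d_v]$ and rows indexed by pairs $(F,\mathbf{e})$, $F$ a facet, $\mathbf{e}\in\prod_{v\in F}[d_v]$; entry $1$ iff $\mathbf{e}=\mathbf{i}|_F$. An integer matrix $A$ is unimodular if every circuit of $A$ (a nonzero integer vector in $\ker A$ with relatively prime entries and inclusion-minimal support among nonzero kernel vectors) has all entries in $\{0,\pm1\}$. $\Delta_k$ is the complex on a $(k+1)$-set with that set as its only facet; $\Delta_m\sqcup\Delta_n$ is the disjoint union; the Alexander dual of $\mathcal{C}$ on $V$ is $\{S\subseteq V: V\setminus S\notin\mathcal{C}\}$, and $D_{m,n}=(\Delta_m\sqcup\Delta_n)^*$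 (on $m+n+2$ vertices; its facets are the sets omitting exactly one vertex of each of the two blocks). $\operatorname{cone}^p(\mathcal{C})$ adds $p$ new vertices $u_1,\dots,u_p$ and has facets $F\cup\{u_1,\dots,u_p\}$; $G(\mathcal{C})$ is $\mathcal{C}$ with one new vertex added to the ground set lying in no face; for $\mathcal{C}$ on $[n]$, $\Lambda(\mathcal{C})$ is the complex on $[n+1]$ with facets $[n]$ and $F\cup\{n+1\}$ for $F$ a facet of $\mathcal{C}$. *)

(* Defs.v *)
From mathcomp Require Import all_boot all_order all_algebra.
Set Implicit Arguments. Unset Strict Implicit. Unset Printing Implicit Defensive.
Import GRing.Theory Num.Theory.
Local Open Scope ring_scope.

(* Vertices of a ground set of size N are 'I_N; a simplicial complex on 'I_N
   is given by its family of faces, a {set {set 'I_N}}. *)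
Definition complex (N : nat) := {set {set 'I_N}}.

Definition facet N (C : complex N) (F : {set 'I_N}) : bool :=
  (F \in C) && [forall G in C, (F \subset G) ==> (G == F)].

Definition gen N (Fs : pred {set 'I_N}) : complex N :=
  [set S : {set 'I_N} | [exists F : {set 'I_N}, Fs F && (S \subset F)]].

Definition block1 m n : {set 'I_(m + n + 2)} := [set v : 'I_(m + n + 2) | (v <= m)%N].
Definition block2 m n : {set 'I_(m + n + 2)} := ~: block1 m n.
Definition DeltaSqcup m n : complex (m + n + 2) :=
  [set S : {set 'I_(m + n + 2)} | (S \subset block1 m n) || (S \subset block2 m n)].

Definition alex_dual N (C : complex N) : complex N := [set S : {set 'I_N} | (~: S) \notin C].

Definition Dmn m n : complex (m + n + 2) := alex_dual (DeltaSqcup m n).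

Definition emb_cone N p (S : {set 'I_N}) : {set 'I_(N + p)} := [set lshift p v | v in S].
Definition emb1 N (S : {set 'I_N}) : {set 'I_N.+1} := [set widen_ord (leqnSn N) v | v in S].

Definition cone_op N p (C : complex N) : complex (N + p) :=
  gen (fun T => [exists F, facet C F && (T == emb_cone p F :|: [set rshift N u | u : 'I_p])]).

Definition G_op N (C : complex N) : complex N.+1 := [set emb1 S | S in C].

Definition Lambda_op N (C : complex N) : complex N.+1 :=
  gen (fun T => (T == emb1 [set: 'I_N]) ||
                [exists F, facet C F && (T == ord_max |: emb1 F)]).

Inductive built (m n : nat) : forall N : nat, complex N -> {set 'I_N} -> {set 'I_N} -> Prop :=
  | built_base : built m n (Dmn m n) [set: 'I_(m + n + 2)] set0
  | built_cone N p C W L : @built m n N C W L ->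
      built m n (cone_op p C) (emb_cone p W) (emb_cone p L)
  | built_G N C W L : @built m n N C W L ->
      built m n (G_op C) (emb1 W) (emb1 L)
  | built_Lambda N C W L : @built m n N C W L ->
      built m n (Lambda_op C) (emb1 W) (ord_max |: emb1 L).

Definition col_t N (d : 'I_N -> nat) := {dffun forall v : 'I_N, 'I_(d v)}.

(* u in ker A_{C,d}: for each row (F, e), e = j|_F, the sum of u over columns i
   with i|_F = e vanishes. *)
Definition in_ker (R : nmodType) N (C : complex N) (d : 'I_N -> nat) (u : col_t d -> R) : Prop :=
  forall F, facet C F -> forall j : col_t d,
    \sum_(i : col_t d | [forall v in F, i v == j v]) u i = 0.

Definition supp (R : nmodType) N (d : 'I_N -> nat) (u : col_t d -> R) : {set col_t d} :=
  [set i | u i != 0].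

Definition circuit N (C : complex N) (d : 'I_N -> nat) (u : col_t d -> int) : Prop :=
  [/\ supp u != set0,
      in_ker C u,
      \big[gcdn/0%N]_(i : col_t d) `|u i|%N = 1%N &
      forall w : col_t d -> rat, in_ker C w -> supp w != set0 ->
        supp w \subset supp u -> supp w = supp u].

Definition unimodular N (C : complex N) (d : 'I_N -> nat) : Prop :=
  forall u : col_t d -> int, circuit C u -> forall i, `|u i| <= 1.

(* Main.v *)
Require Import Defs.
From mathcomp Require Import all_boot all_order all_algebra.
From mathcomp Require Import ring lra zify.
From Stdlib Require Import Classical.
Set Implicit Arguments. Unset Strict Implicit. Unset Printing Implicit Defensive.
Import Order.TTheory GRing.Theory Num.Theory.
Local Open Scope ring_scope.

(* Unimodularity says that the support of every nonzero rational kernel vector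
   contains the support of a nonzero kernel vector with entries 0, 1, -1
   ([signed_elim]), a property inherited along signed pullbacks of tables
   ([embeds]). The kernel of C embeds in that of each of its cone, G and Lambda;
   cone and G preserve [signed_elim], and for a Lawrence vertex with two values
   the kernels of C and Lambda C are isomorphic through u |-> (u, -u).

   After multiplication by the sign (-1)^(x_1 + ... + x_N), the kernel of the
   binary D_{m,n}, with blocks A and B, consists of the functions
   g(x_A) - f(x_B): this is the cut space of a complete bipartite graph, and
   thresholding the potential (g, f) yields a cut.

   For the converse there are two rigid kernel vectors with an entry -2.
   If a Lawrence vertex has three values, the kernel of Lambda C contains the
   triples of elements of ker C with sum 0, hence (pulling back to D_{m,n}) the
   triple p, q, -(p + q) with p = x_b1 - x_a1 and q = x_b2 - x_a2.
   If a vertex v of A in D_{m,n} has three values, the layers x_b1 - x_a,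
   x_b2 - x_a, x_a - x_b1 - x_b2 do the same. In both cases the zeros determine
   the vector up to a scalar. *)

(** * Signed elimination and signed pullbacks of tables *)

Definition signed_elim (X : finType) (K : (X -> rat) -> Prop) : Prop :=
  forall u, K u -> (exists x, u x != 0) ->
  exists w, [/\ K w, exists x, w x != 0, forall x, w x != 0 -> u x != 0 &
                forall x, w x != 0 -> `|w x| = 1].

(** The maps [u |-> s * (u o p)] and [w |-> t * (w o q)] are mutually inverse between [K] and the
    members of [K'] that vanish wherever [s] does. As [|t| = 1], the way back preserves absolute
    values. *)
Definition embeds (X X' : finType) (K : (X -> rat) -> Prop)
    (K' : (X' -> rat) -> Prop) : Prop :=
  exists (s : X' -> rat) (p : X' -> X) (t : X -> rat) (q : X -> X'),
  [/\ forall x, `|t x| = 1,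
      forall u, K u -> K' (fun y => s y * u (p y)) /\
                       forall x, t x * (s (q x) * u (p (q x))) = u x &
      forall w, K' w -> (forall y, s y = 0 -> w y = 0) ->
        K (fun x => t x * w (q x)) /\
        forall y, w y = s y * (t (p y) * w (q (p y)))].

(** Eliminate in [K'] below the image of [u]: the vector found vanishes where [s] does, so it comes
    back to [K], with the same absolute values because [|t| = 1]. *)
Lemma signed_elim_embeds (X X' : finType) (K : (X -> rat) -> Prop)
    (K' : (X' -> rat) -> Prop) :
  embeds K K' -> signed_elim K' -> signed_elim K.
Proof.
move=> [s [p [t [q [t1 KK' K'K]]]]] eK' u Ku [x ux].
have [K'u tu] := KK' _ Ku.
have [|w [K'w [y wy] wu w1]] := eK' _ K'u.
  exists (q x); apply: contraNneq ux => su0.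
  by rewrite -tu su0 mulr0.
have sw z : s z = 0 -> w z = 0.
  by move=> sz; apply/eqP; apply: contraT => /wu; rewrite sz mul0r eqxx.
have [Kw wE] := K'K _ K'w sw.
have t_neq0 z : t z != 0 by rewrite -normr_gt0 t1.
exists (fun x => t x * w (q x)); split=> //.
- exists (p y); apply: contraNneq wy => tw0.
  by rewrite wE tw0 mulr0.
- move=> z; rewrite mulf_eq0 negb_or => /andP[tz /wu].
  by apply: contraNneq => uz; rewrite -(mulrI_eq0 _ (mulfI tz)) tu uz.
- by move=> z; rewrite mulf_eq0 negb_or normrM t1 mul1r => /andP[_ /w1].
Qed.

(** This is the kernel of a Lawrence lifting whose new vertex has three values, [k] being that
    value. *)
Definition triple (X : finType) (K : (X -> rat) -> Prop)
    (u : X * 'I_3 -> rat) : Prop :=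
  (forall k, K (fun x => u (x, k))) /\ forall x, \sum_(k < 3) u (x, k) = 0.

Lemma embeds_triple (X X' : finType) (K : (X -> rat) -> Prop)
    (K' : (X' -> rat) -> Prop) :
  embeds K K' -> embeds (triple K) (triple K').
Proof.
move=> [s [p [t [q [t1 KK' K'K]]]]].
exists (fun y => s y.1), (fun y => (p y.1, y.2)), (fun x => t x.1),
       (fun x => (q x.1, x.2)).
split=> [x|u [Ku u0]|w [K'w w0] sw]; first exact: t1.
  split; last by case=> x k /=; have [_ ->] := KK' _ (Ku k).
  split=> [k|x] /=; first by have [] := KK' _ (Ku k).
  by rewrite -mulr_sumr u0 mulr0.
have Kwk k := K'K _ (K'w k) (fun y => sw (y, k)).
split; last by case=> y k /=; have [_ /(_ y)] := Kwk k.
split=> [k|x] /=; first by have [] := Kwk k.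
by rewrite -mulr_sumr w0 mulr0.
Qed.

(** * Circuits *)

Lemma in_ker_lin N (C : complex N) d (a b : rat) (u w : col_t d -> rat) :
  in_ker C u -> in_ker C w -> in_ker C (fun i => a * u i + b * w i).
Proof.
move=> Ku Kw F FC j; rewrite big_split /= -!mulr_sumr Ku // Kw //.
by rewrite !mulr0 addr0.
Qed.

Lemma in_ker_intr N (C : complex N) d (u : col_t d -> int) :
  in_ker C u <-> in_ker C (fun i => (u i)%:~R : rat).
Proof.
split=> Ku F FC j.
  by rewrite -rmorph_sum /= Ku.
by apply/eqP; rewrite -(intr_eq0 rat) rmorph_sum /= Ku.
Qed.

Lemma supp_neq0 (R : nmodType) N (d : 'I_N -> nat) (u : col_t d -> R) :
  (supp u != set0) <-> exists x, u x != 0.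
Proof.
split=> [/set0Pn[x]|[x ux]]; first by rewrite inE; exists x.
by apply/set0Pn; exists x; rewrite inE.
Qed.

Definition min_supp N (C : complex N) (d : 'I_N -> nat) (u : col_t d -> rat) :=
  forall w : col_t d -> rat, in_ker C w -> supp w != set0 ->
    supp w \subset supp u -> supp w = supp u.

(** The combination [u x * w - w x * u] is in the kernel and vanishes at [x], so its support is
    strictly inside that of [u]; minimality makes it zero. *)
Lemma min_supp_prop N (C : complex N) d (u w : col_t d -> rat) x :
  in_ker C u -> min_supp C u -> in_ker C w -> supp w \subset supp u ->
  u x != 0 -> forall y, u x * w y = w x * u y.
Proof.
move=> Ku minu Kw wu ux y.
pose v := fun i => u x * w i + (- w x) * u i.
have Kv : in_ker C v by exact: in_ker_lin.
have vu : supp v \subset supp u.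
  apply/subsetP => i; rewrite !inE; apply: contraNneq => ui0.
  have : i \notin supp w by apply/negP => /(subsetP wu); rewrite inE ui0 eqxx.
  by rewrite inE negbK /v ui0 mulr0 addr0 => /eqP->; rewrite mulr0.
have v0 : supp v = set0.
  apply/eqP/negPn/negP => vn0.
  have /setP/(_ x) := minu _ Kv vn0 vu.
  by rewrite !inE ux /v mulNr mulrC addrN eqxx.
have /setP/(_ y) := v0; rewrite !inE => /negbT; rewrite negbK /v mulNr subr_eq0.
by move/eqP.
Qed.

Lemma min_supp_exists N (C : complex N) d (u : col_t d -> rat) :
  in_ker C u -> supp u != set0 ->
  exists w : col_t d -> rat,
    [/\ in_ker C w, supp w != set0, supp w \subset supp u & min_supp C w].
Proof.
have [k] := ubnP #|supp u|; elim: k u => // k IH u uk Ku u0.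
have [minu|] := classic (min_supp C u); first by exists u.
move=> /not_all_ex_not[w h].
have [Kw {}h] := imply_to_and _ _ h.
have [w0 {}h] := imply_to_and _ _ h.
have [wu wneq] := imply_to_and _ _ h.
have wpu : supp w \proper supp u by rewrite properEneq wu andbT; apply/eqP.
have [v [Kv v0 vw minv]] := IH w (leq_trans (proper_card wpu) uk) Kw w0.
by exists v; split=> //; apply: subset_trans vw wu.
Qed.

(** Multiply by the product of all denominators, then divide by the gcd [g] of the resulting
    integers. *)
Lemma primitive_multiple (X : finType) (u : X -> rat) :
  (exists x, u x != 0) ->
  exists (v : X -> int) (a : rat), [/\ a != 0, forall x, (v x)%:~R = a * u x &
    \big[gcdn/0%N]_x `|v x|%N = 1%N].
Proof.
move=> [x0 ux0].
pose D := \prod_x denq (u x).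
have D0 : D != 0 by apply/prodf_neq0 => x _; rewrite denq_neq0.
pose z x := numq (u x) * \prod_(y | y != x) denq (u y).
have zE x : (z x)%:~R = D%:~R * u x :> rat.
  have -> : D = denq (u x) * \prod_(y | y != x) denq (u y).
    by rewrite /D (bigD1 x).
  by rewrite !intrM numqE [RHS]mulrC mulrA.

pose g := \big[gcdn/0%N]_x `|z x|%N.
have gz x : (g %| `|z x|)%N by exact: (biggcdn_inf x).
have zx0 : z x0 != 0 by rewrite -(intr_eq0 rat) zE mulf_neq0 ?intr_eq0.
have g0 : (0 < g)%N.
  by rewrite lt0n; apply: contraNneq zx0 => g0; have := gz x0; rewrite g0 dvd0n absz_eq0.
have gZ : g%:Z != 0 by rewrite eqz_nat -lt0n.
have vE x : z x = (z x %/ g)%Z * g by rewrite divzK // dvdzE.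
exists (fun x => (z x %/ g)%Z), (D%:~R / g%:~R); split.
- by rewrite mulf_neq0 ?invr_eq0 ?intr_eq0 ?D0 ?gZ.
- move=> x; rewrite mulrAC -zE {2}vE intrM mulfK ?intr_eq0 //.
(* The gcd is homogeneous: [g] times the gcd of the quotients is the gcd of the [z x], that is [g],
   and [g > 0] cancels. *)
- have : (g * \big[gcdn/0%N]_x `|(z x %/ g)%Z|%N = g)%N.
    rewrite {3}/g.
    elim/big_rec2: _ => [|x a b _ <-]; first by rewrite muln0.
    by rewrite muln_gcdr {2}vE abszM absz_nat mulnC.
  by move/eqP; rewrite -{3}[g]muln1 eqn_pmul2l // => /eqP.
Qed.

(** Forward: below [u] there is a kernel vector of minimal support, and its primitive multiple is a
    circuit. Backward: a sign vector supported in a circuit [u] is proportional to [u], so the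
    nonzero entries of [u] share one absolute value, which divides their gcd 1. *)
Lemma unimodularP N (C : complex N) d :
  unimodular C d <-> signed_elim (@in_ker rat N C d).
Proof.
split=> [uniC u Ku /supp_neq0 u0|elC u [u0 Ku gu minu] i].
  have [w [Kw w0 wu minw]] := min_supp_exists Ku u0.
  have [v [a [a0 vE gv]]] := primitive_multiple ((supp_neq0 w).1 w0).
  have sv : supp v = supp w.
    by apply/setP=> x; rewrite !inE -(intr_eq0 rat) vE mulf_eq0 negb_or a0.
  have cv : circuit C v.
    split=> //; first by rewrite sv.
    - apply/in_ker_intr => F FC j.
      rewrite (eq_bigr (fun i => a * w i)) //.
      by rewrite -mulr_sumr Kw // mulr0.
    - by rewrite sv.
  exists (fun i => (v i)%:~R); split.
  - exact: (in_ker_intr _ _).1 (let: And4 _ h _ _ := cv in h).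
  - have /supp_neq0[x vx] : supp v != set0 by rewrite sv.
    by exists x; rewrite intr_eq0.
  - move=> x; rewrite intr_eq0 => vx; have := subsetP wu x.
    by rewrite -sv !inE; apply.
  - move=> x; rewrite intr_eq0 => vx.
    have /= := uniC v cv x; rewrite -intr_norm => v1.
    have -> // : `|v x| = 1.
    by apply/eqP; rewrite eq_le v1 /= -gtz0_ge1 normr_gt0.
pose ur := fun i => (u i)%:~R : rat.
have sur : supp ur = supp u by apply/setP=> x; rewrite !inE intr_eq0.
have Kur : in_ker C ur by apply/in_ker_intr.
have minur : min_supp C ur by move=> w Kw w0; rewrite sur; exact: minu.
have [|w [Kw w0 wu w1]] := elC ur Kur; first by apply/supp_neq0; rewrite sur.
have swu : supp w \subset supp ur by apply/subsetP=> x; rewrite !inE; apply: wu.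
have [x ux] := (supp_neq0 u).1 u0.
have urx : ur x != 0 by rewrite intr_eq0.
have prop := min_supp_prop Kur minur Kw swu urx.
have swE : supp w = supp ur by apply: minur => //; apply/supp_neq0.
have wx1 y : u y != 0 -> `|w y| = 1.
  by move=> uy; apply: w1; have /setP/(_ y) := swE; rewrite !inE intr_eq0 uy.
have absu y : u y != 0 -> `|u y|%N = `|u x|%N.
  move=> uy; have := congr1 Num.norm (prop y).
  rewrite !normrM !wx1 // mulr1 mul1r /ur -!intr_norm => /intr_inj.
  by rewrite -!abszE => -[].
have dv : (`|u x| %| \big[gcdn/0%N]_i `|u i|)%N.
  apply/dvdn_biggcdP => y _.
  by have [->|uy] := eqVneq (u y) 0; [rewrite absz0 dvdn0 | rewrite absu].
have ux1 : `|u x|%N = 1%N by apply/eqP; rewrite -dvdn1 -gu.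
have [->|ui] := eqVneq (u i) 0; first by rewrite normr0.
by rewrite -abszE absu // ux1.
Qed.

(** * Margins *)

Definition agree N (d : 'I_N -> nat) (S : {set 'I_N}) (i j : col_t d) : bool :=
  [forall v in S, i v == j v].

Definition margin N (d : 'I_N -> nat) (S : {set 'I_N}) (u : col_t d -> rat)
    (j : col_t d) : rat :=
  \sum_(i | agree S i j) u i.

Lemma agreeP N (d : 'I_N -> nat) (S : {set 'I_N}) (i j : col_t d) :
  reflect (forall v, v \in S -> i v = j v) (agree S i j).
Proof. by apply: (iffP forall_inP) => h v /h /eqP. Qed.

Lemma agree_refl N (d : 'I_N -> nat) (S : {set 'I_N}) (i : col_t d) : agree S i i.
Proof. exact/agreeP. Qed.

Lemma agreeC N (d : 'I_N -> nat) (S : {set 'I_N}) (i j : col_t d) :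
  agree S i j = agree S j i.
Proof. by apply/agreeP/agreeP => h v /h. Qed.

Lemma agree_transl N (d : 'I_N -> nat) (S : {set 'I_N}) (i j k : col_t d) :
  agree S i j -> agree S i k = agree S j k.
Proof.
move=> /agreeP ij; apply/agreeP/agreeP => h v vS; first by rewrite -ij ?h.
by rewrite ij ?h.
Qed.

Lemma eq_margin N (d : 'I_N -> nat) (S : {set 'I_N}) (u w : col_t d -> rat) j :
  u =1 w -> margin S u j = margin S w j.
Proof. by move=> uw; apply: eq_bigr => i _. Qed.

(** Grouping columns by their restriction to [T] writes a margin over [S] as a sum of margins over
    [T]. *)
Lemma margin_subset N (d : 'I_N -> nat) (S T : {set 'I_N}) (u : col_t d -> rat) :
  S \subset T -> (forall j, margin T u j = 0) -> forall j, margin S u j = 0.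
Proof.
move=> ST uT j.
(* The representative of the class of [i]: it keeps [i] on [T] and copies [j] elsewhere. *)
pose r (i : col_t d) : col_t d := [ffun v => if v \in T then i v else j v].
rewrite /margin (partition_big r (fun c => agree S c j && (r c == c))) /=.
  rewrite big1 // => c /andP[/agreeP cj /eqP rc].
  rewrite -[RHS](uT c); apply: eq_bigl => i; apply/andP/agreeP.
    by case=> _ /eqP <- v vT; rewrite ffunE vT.
  move=> ic; split.
    by apply/agreeP => v vS; rewrite ic ?cj // (subsetP ST).
  apply/eqP/ffunP => v; rewrite -rc !ffunE; case: ifP => // vT.
  exact: ic.
move=> i /agreeP ij; apply/andP; split.
  by apply/agreeP => v vS; rewrite ffunE ij ?if_same.
by apply/eqP/ffunP => v; rewrite !ffunE; case: (v \in T).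
Qed.

Lemma face_in_facet N (C : complex N) S :
  S \in C -> exists2 F, facet C F & S \subset F.
Proof.
move=> SC; have [F /maxsetP[FC maxF] SF] := maxset_exists (P := fun F => F \in C) SC.
exists F => //; rewrite /facet FC /=.
by apply/forall_inP => G GC; apply/implyP => FG; rewrite (maxF G).
Qed.

(** Margins over faces are sums of margins over facets; working with all faces spares a description
    of the facets of each constructed complex. *)
Lemma in_kerP N (C : complex N) d (u : col_t d -> rat) :
  in_ker C u <-> forall S, S \in C -> forall j, margin S u j = 0.
Proof.
split=> [Ku S SC|Ku F /andP[FC _]]; last exact: Ku.
by have [F /Ku FC /margin_subset] := face_in_facet SC; apply.
Qed.

Lemma in_ker_gen N (Fs : pred {set 'I_N}) d (u : col_t d -> rat) :
  in_ker (gen Fs) u <-> forall F, Fs F -> forall j, margin F u j = 0.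
Proof.
rewrite in_kerP; split=> Ku F.
  by move=> FF; apply: Ku; rewrite inE; apply/existsP; exists F; rewrite FF subxx.
rewrite inE => /existsP[G /andP[/Ku uG FG]]; exact: margin_subset FG uG.
Qed.

Lemma eq_in_ker N (C : complex N) d (u w : col_t d -> rat) :
  u =1 w -> in_ker C u -> in_ker C w.
Proof. by move=> uw Ku F FC j; rewrite -[RHS](Ku F FC j); apply: eq_bigr => i _. Qed.

Lemma in_ker_eq0 N (C : complex N) d (u : col_t d -> rat) :
  (forall i, u i = 0) -> in_ker C u.
Proof. by move=> u0 F _ j; rewrite big1. Qed.

Lemma in_kerZ N (C : complex N) d a (u : col_t d -> rat) :
  in_ker C u -> in_ker C (fun i => a * u i).
Proof. by move=> Ku F FC j; rewrite -mulr_sumr Ku ?mulr0. Qed.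

(** * Enlarging the ground set *)

Section Glue.

Variables (N N' : nat) (emb : 'I_N -> 'I_N') (d' : 'I_N' -> nat).
Hypothesis emb_inj : injective emb.

Local Notation d := (fun v => d' (emb v)).
Local Notation new := (~: (emb @: [set: 'I_N])).

Definition res (c : col_t d') : col_t d := [ffun v => c (emb v)].

(** Old coordinates come from [c], new ones from [e]. The detour through [nat] and [insubd] replaces
    a cast along [emb u = v]; the value is always in range, so the default [e v] is not taken. *)
Definition glue (c : col_t d) (e : col_t d') : col_t d' :=
  [ffun v => insubd (e v)
     (if [pick u | emb u == v] is Some u then c u : nat else e v)].

Lemma glue_emb c e v : glue c e (emb v) = c v.
Proof.
apply: val_inj; rewrite ffunE; case: pickP => [u /eqP/emb_inj ->|/(_ v)].
  by rewrite val_insubd ltn_ord.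
by rewrite eqxx.
Qed.

Lemma glue_new c e v : v \in new -> glue c e v = e v.
Proof.
rewrite inE => vn; apply: val_inj; rewrite ffunE.
case: pickP => [u /eqP uv|_]; last by rewrite val_insubd ltn_ord.
by rewrite -uv imset_f in vn.
Qed.

Lemma res_glue c e : res (glue c e) = c.
Proof. by apply/ffunP => v; rewrite ffunE glue_emb. Qed.

Lemma agree_glue c e : agree new (glue c e) e.
Proof. by apply/agreeP => v; apply: glue_new. Qed.

Lemma glue_res i e : agree new i e -> glue (res i) e = i.
Proof.
move=> /agreeP ie; apply/ffunP => v; have [vn|] := boolP (v \in new).
  by rewrite glue_new // ie.
by rewrite !inE negbK => /imsetP[w _ ->]; rewrite glue_emb ffunE.
Qed.

Lemma glue_agree c e f : agree new e f -> glue c e = glue c f.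
Proof.
move=> ef; rewrite -(@glue_res (glue c e) f) ?res_glue //.
by apply/agreeP => v vn; rewrite glue_new // (agreeP _ _ _ ef).
Qed.

Lemma agree_emb (S : {set 'I_N}) (i j : col_t d') :
  agree (emb @: S) i j = agree S (res i) (res j).
Proof.
apply/agreeP/agreeP => h v.
  by move=> vS; rewrite !ffunE h // imset_f.
by case/imsetP => w wS ->; have := h w wS; rewrite !ffunE.
Qed.

Lemma agreeU (S T : {set 'I_N'}) (i j : col_t d') :
  agree (S :|: T) i j = agree S i j && agree T i j.
Proof.
apply/agreeP/andP => [h|[/agreeP hS /agreeP hT] v].
  by split; apply/agreeP => v vS; apply: h; rewrite inE vS ?orbT.
by rewrite inE => /orP[/hS|/hT].
Qed.

(** Faces containing all new vertices see a table slice by slice, as for the facets of a cone;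
    [c |-> glue c e] enumerates one slice. *)
Lemma margin_slice (S : {set 'I_N}) (u : col_t d' -> rat) e :
  margin (emb @: S :|: new) u e = margin S (fun c => u (glue c e)) (res e).
Proof.
rewrite /margin (reindex_onto (glue^~ e) res) /=; last first.
  by move=> i; rewrite agreeU => /andP[_ /glue_res].
by apply: eq_bigl => c; rewrite agreeU agree_emb agree_glue res_glue eqxx !andbT.
Qed.

Definition fibre_sum (u : col_t d' -> rat) (c : col_t d) : rat :=
  \sum_(i | res i == c) u i.

(** Faces without new vertices see a table only through its sums over the new coordinates, as in
    [G_op] and for the facet [[n]] of a Lawrence lifting. *)
Lemma margin_fibre (S : {set 'I_N}) (u : col_t d' -> rat) e :
  margin (emb @: S) u e = margin S (fibre_sum u) (res e).
Proof.
rewrite /margin (partition_big res (agree S ^~ (res e))) /=; last first.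
  by move=> i; rewrite agree_emb.
apply: eq_bigr => c ce; apply: eq_bigl => i; rewrite agree_emb.
by apply: andb_idl => /eqP->.
Qed.

Lemma margin_fibreT (u : col_t d' -> rat) e :
  margin (emb @: [set: 'I_N]) u e = fibre_sum u (res e).
Proof.
rewrite margin_fibre /margin (big_pred1 (res e)) // => c.
apply/agreeP/eqP => [h|-> //]; apply/ffunP => v; exact: h.
Qed.

(** Applied with [T] equal to [unit], [bool] and ['I_3], to tables living on one, two or three
    slices. *)
Lemma fibre_sum_supp (T : finType) (e : T -> col_t d') (u : col_t d' -> rat) c :
  (forall k l, agree new (e k) (e l) -> k = l) ->
  (forall i, (forall k, ~~ agree new i (e k)) -> u i = 0) ->
  fibre_sum u c = \sum_k u (glue c (e k)).
Proof.
move=> e_inj u0; rewrite /fibre_sum (bigID (fun i => [exists k, agree new i (e k)])) /=.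
rewrite [X in _ + X]big1 ?addr0; last first.
  by move=> i /andP[_ /existsPn/u0].
(* Exactly one [k] matches such a column, so [u i] is itself a sum over the matching [k], and the
   two sums can be exchanged. *)
rewrite (eq_bigr (fun i => \sum_(k | agree new i (e k)) u i)); last first.
  move=> i /andP[_ /existsP[k ik]]; rewrite (big_pred1 k) // => l.
  apply/idP/eqP => [il|-> //]; apply: e_inj; apply/agreeP => v vn.
  by rewrite -(agreeP _ _ _ ik) // (agreeP _ _ _ il).
rewrite (exchange_big_dep predT) //=; apply: eq_bigr => k _.
rewrite (big_pred1 (glue c (e k))) // => i.
apply/andP/eqP => [[/andP[/eqP <- _] /glue_res //]|->].
rewrite res_glue agree_glue eqxx; split=> //.
by apply/existsP; exists k; exact: agree_glue.
Qed.

(** * Kernels of the cone and of G *)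

Section Kernels.

Variable C : complex N.

Definition slices_ker (u : col_t d' -> rat) :=
  forall e, in_ker C (fun c => u (glue c e)).

Lemma slices_kerP (u : col_t d' -> rat) :
  slices_ker u <-> forall F, facet C F -> forall e, margin (emb @: F :|: new) u e = 0.
Proof.
split=> [Ku F FC e|Ku e F FC j]; first by rewrite margin_slice; exact: Ku.
rewrite -[LHS]/(margin F _ j) -[j](res_glue _ e).
rewrite -[RHS](Ku F FC (glue j e)) margin_slice; apply: eq_margin => c.
by rewrite (@glue_agree c (glue j e) e) // agree_glue.
Qed.

Lemma slices_ker_pullback (s : col_t d' -> rat) (u : col_t d -> rat) :
  (forall i j, agree new i j -> s i = s j) -> in_ker C u ->
  slices_ker (fun i => s i * u (res i)).
Proof.
move=> sP Ku e; apply: (eq_in_ker (u := fun c => s e * u c)); last exact: in_kerZ.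
by move=> c; rewrite res_glue (sP _ e) ?agree_glue.
Qed.

(** [K'] stands for the kernel of the enlarged complex, known only through conditions on slices and
    fibre sums. *)
Variable K' : (col_t d' -> rat) -> Prop.

(** A kernel vector of [C] is placed on the single slice at [e] and extended by zero. *)
Lemma cone_embeds (e : col_t d') :
  (forall u, K' u <-> slices_ker u) -> embeds (@in_ker rat N C d) K'.
Proof.
move=> K'E.
exists (fun i => (agree new i e)%:R), res, (fun=> 1), (glue^~ e); split=> //.
  move=> u Ku; split; last by move=> x; rewrite agree_glue res_glue !mul1r.
  by apply/K'E/slices_ker_pullback => // i j /agree_transl->.
move=> w /K'E Kw sw; split.
  by apply: eq_in_ker (Kw e) => c; rewrite mul1r.
move=> i; rewrite mul1r; case: (boolP (agree new i e)) (sw i) => [ie _|_ -> //].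
  by rewrite mul1r glue_res.
by rewrite mul0r.
Qed.

(** Eliminate inside the slice through a nonzero entry and extend by zero. *)
Lemma cone_signed_elim :
  (forall u, K' u <-> slices_ker u) ->
  signed_elim (@in_ker rat N C d) -> signed_elim K'.
Proof.
move=> K'E eC u /K'E Ku [x ux].
have [|w [Kw [y wy] wu w1]] := eC _ (Ku x).
  by exists (res x); rewrite glue_res //; apply/agreeP.
exists (fun i => (agree new i x)%:R * w (res i)); split.
- by apply/K'E/slices_ker_pullback => // i j /agree_transl->.
- by exists (glue y x); rewrite agree_glue res_glue mul1r.
- move=> i; case: (boolP (agree new i x)) => [ix|]; last by rewrite mul0r eqxx.
  by rewrite mul1r => /wu; rewrite glue_res.
- by move=> i; case: (agree new i x); rewrite ?mul0r ?eqxx // mul1r => /w1.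
Qed.

(** For a table living on the slice at [e], the fibre sums are the entries of that slice. *)
Lemma G_embeds (e : col_t d') :
  (forall u, K' u <-> in_ker C (fibre_sum u)) -> embeds (@in_ker rat N C d) K'.
Proof.
move=> K'E.
have fibreE (u : col_t d' -> rat) c :
    (forall i, ~~ agree new i e -> u i = 0) -> fibre_sum u c = u (glue c e).
  move=> u0; rewrite (@fibre_sum_supp unit (fun=> e)) ?big_const ?card_unit //=.
  - by rewrite addr0.
  - by move=> [] [].
  - by move=> i /(_ tt)/u0.
exists (fun i => (agree new i e)%:R), res, (fun=> 1), (glue^~ e); split=> //.
  move=> u Ku; split; last by move=> x; rewrite agree_glue res_glue !mul1r.
  apply/K'E; apply: eq_in_ker Ku => c; rewrite fibreE.
    by rewrite agree_glue res_glue mul1r.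
  by move=> i /negbTE->; rewrite mul0r.
move=> w /K'E Kw sw.
have w0 i : ~~ agree new i e -> w i = 0 by move=> /negbTE ie; apply: sw; rewrite ie.
split; first by apply: eq_in_ker Kw => c; rewrite mul1r fibreE.
move=> i; rewrite mul1r; case: (boolP (agree new i e)) => [ie|/w0 ->].
  by rewrite mul1r glue_res.
by rewrite mul0r.
Qed.

Lemma G_signed_elim :
  (forall u, K' u <-> in_ker C (fibre_sum u)) ->
  signed_elim (@in_ker rat N C d) -> signed_elim K'.
Proof.
move=> K'E eC u /K'E Ku [x ux].
(* If all fibre sums vanish, the fibre of [x] has a second nonzero entry [y], and the indicator of
   [x] minus that of [y] is in the kernel. Otherwise elimination applies to the fibre sums
   themselves. *)
have [/forallP u0|/forallPn[c uc]] := boolP [forall c, fibre_sum u c == 0].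
  have [y yx uy] : exists2 y, (y != x) && (res y == res x) & u y != 0.
    apply/exists_inP; apply: contraT => /exists_inPn h.
    have := u0 (res x); rewrite /fibre_sum (bigD1 x) //= big1 ?addr0 ?(negbTE ux) //.
    by move=> y; rewrite andbC => /h; rewrite negbK => /eqP.
  case/andP: yx => yx /eqP ryx.
  exists (fun i => (i == x)%:R - (i == y)%:R); split.
  - apply/K'E; apply: in_ker_eq0 => c.
    rewrite /fibre_sum; have [<-|xc] := eqVneq (res x) c; last first.
      rewrite big1 // => i ic; have [ix|_] := eqVneq i x.
        by rewrite -ix ic in xc.
      have [iy|_] := eqVneq i y; last by rewrite subr0.
      by rewrite -ryx -iy ic in xc.
    rewrite (bigD1 x) //= (bigD1 y) ?ryx ?eqxx //= (negbTE yx) (eq_sym x) (negbTE yx).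
    rewrite big1 ?addr0 ?subr0 ?sub0r ?subrr // => i /andP[/andP[_ /negbTE->] /negbTE->].
    by rewrite subr0.
  - by exists x; rewrite eqxx (eq_sym x) (negbTE yx) subr0 oner_eq0.
  - move=> i; have [-> //|_] := eqVneq i x; have [-> //|_] := eqVneq i y.
    by rewrite subr0 eqxx.
  - move=> i; case: (i == x); case: (i == y);
      by rewrite ?subrr ?subr0 ?sub0r ?eqxx ?normrN ?normr1.
have [|w [Kw [y wy] wu w1]] := eC _ Ku; first by exists c.
(* A nonzero fibre sum over [a] has a nonzero term; [pk a] selects one such column, and it alone
   receives the value [w a]. *)
pose pk a := [pick i | (res i == a) && (u i != 0)].
have pkP a : w a != 0 -> exists2 i, pk a = Some i & (res i == a) /\ u i != 0.
  move=> /wu ua; rewrite /pk; case: pickP => [i /andP[? ?]|no]; first by exists i.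
  case/negP: ua; rewrite /fibre_sum big1 // => i ia.
  by have := no i; rewrite ia /= => /negbFE/eqP.
exists (fun i => (pk (res i) == Some i)%:R * w (res i)); split.
- apply/K'E; apply: eq_in_ker Kw => a; rewrite /fibre_sum.
  have [wa|/pkP[i pi [/eqP ia _]]] := eqVneq (w a) 0.
    by rewrite wa big1 // => i /eqP->; rewrite wa mulr0.
  rewrite (bigD1 i) ?ia //= pi eqxx mul1r big1 ?addr0 // => k /andP[/eqP-> ki].
  by rewrite pi (inj_eq Some_inj) eq_sym (negbTE ki) mul0r.
- have [i pi [/eqP ri _]] := pkP y wy.
  by exists i; rewrite ri pi eqxx mul1r.
- move=> i; have [pi|_] := boolP (pk _ == _); last by rewrite mul0r eqxx.
  by rewrite mul1r => /pkP[k]; rewrite (eqP pi) => -[<-] [].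
- by move=> i; case: (pk _ == _); rewrite ?mul0r ?eqxx // mul1r => /w1.
Qed.

(** * Lawrence liftings *)

Hypothesis K'E : forall u, K' u <-> slices_ker u /\ forall c, fibre_sum u c = 0.

Section Lawrence.

Variables e0 e1 : col_t d'.
Hypothesis e01 : ~~ agree new e0 e1.

(** The sign pattern of [(u, -u)]: 1 on the slice at [e0], -1 on the slice at [e1], 0 on all
    others. *)
Let s (i : col_t d') : rat := (agree new i e0)%:R - (agree new i e1)%:R.

Let e (b : bool) := if b then e1 else e0.

Let e_inj k l : agree new (e k) (e l) -> k = l.
Proof. by case: k; case: l => //=; rewrite ?(negbTE e01) // agreeC (negbTE e01). Qed.

Let s_agree i j : agree new i j -> s i = s j.
Proof.
by move=> ij; rewrite /s !(agree_transl _ ij).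
Qed.

Let s0 : s e0 = 1.
Proof. by rewrite /s (negbTE e01) agree_refl subr0. Qed.

Let s1 : s e1 = -1.
Proof. by rewrite /s agreeC (negbTE e01) agree_refl sub0r. Qed.

Let fibreE (u : col_t d' -> rat) c :
  (forall i, ~~ agree new i e0 -> ~~ agree new i e1 -> u i = 0) ->
  fibre_sum u c = u (glue c e0) + u (glue c e1).
Proof.
move=> u0; rewrite (fibre_sum_supp _ e_inj) ?big_bool /= 1?addrC // => i h.
exact: u0 (h false) (h true).
Qed.

Let pullback u : in_ker C u -> K' (fun i => s i * u (res i)).
Proof.
move=> Ku; apply/K'E; split; first exact: slices_ker_pullback.
move=> c; rewrite fibreE.
  by rewrite !res_glue !(s_agree (agree_glue _ _)) s0 s1 mul1r mulN1r subrr.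
by move=> i /negbTE h0 /negbTE h1; rewrite /s h0 h1 subrr mul0r.
Qed.

(** When only two slices are nonzero, vanishing fibre sums make one the opposite of the other. *)
Let antisym w : K' w ->
  (forall i, ~~ agree new i e0 -> ~~ agree new i e1 -> w i = 0) ->
  forall i, w i = s i * w (glue (res i) e0).
Proof.
move=> /K'E[_ w0] sw i.
have := w0 (res i); rewrite fibreE // => /eqP; rewrite addr_eq0 => /eqP w01.
have [ie0|n0] := boolP (agree new i e0).
  by rewrite (s_agree ie0) s0 mul1r glue_res.
have [ie1|n1] := boolP (agree new i e1).
  by rewrite (s_agree ie1) s1 mulN1r w01 opprK glue_res.
by rewrite sw // /s (negbTE n0) (negbTE n1) subrr mul0r.
Qed.

Lemma Lambda_embeds : embeds (@in_ker rat N C d) K'.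
Proof.
exists s, res, (fun=> 1), (glue^~ e0); split=> //.
  move=> u Ku; split; first exact: pullback.
  by move=> x; rewrite (s_agree (agree_glue _ _)) s0 !mul1r res_glue.
move=> w Kw sw; have /K'E[Kw0 _] := Kw; split.
  by apply: eq_in_ker (Kw0 e0) => c; rewrite mul1r.
move=> i; rewrite mul1r; apply: antisym => // k /negbTE h0 /negbTE h1.
by apply: sw; rewrite /s h0 h1 subrr.
Qed.

(** When the two slices exhaust the table, the lifted kernel consists of the pairs [(u, -u)]. This
    direction carries signed elimination from [C] up to its lifting. *)
Lemma Lambda2_embeds :
  (forall i, agree new i e0 || agree new i e1) -> embeds K' (@in_ker rat N C d).
Proof.
move=> e01P.
have aS w : K' w -> forall i, w i = s i * w (glue (res i) e0).
  move=> Kw; apply: antisym => // i /negbTE h0 /negbTE h1.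
  by have := e01P i; rewrite h0 h1.
exists (fun=> 1), (glue^~ e0), s, res; split.
- move=> i; case/orP: (e01P i) => /s_agree->; rewrite ?s0 ?s1 ?normrN normr1 //.
- move=> w Kw; split; last by move=> i; rewrite mul1r -aS.
  by have /K'E[Kw0 _] := Kw; apply: eq_in_ker (Kw0 e0) => c; rewrite mul1r.
- move=> u Ku _; split; first exact: pullback.
  by move=> c; rewrite mul1r (s_agree (agree_glue _ _)) s0 mul1r res_glue.
Qed.

End Lawrence.

Lemma Lambda3_embeds (e : 'I_3 -> col_t d') :
  (forall k l, agree new (e k) (e l) -> k = l) ->
  embeds (triple (@in_ker rat N C d)) K'.
Proof.
move=> e_inj.
pose kap i := [pick k | agree new i (e k)].
have kapE c k : kap (glue c (e k)) = Some k.
  rewrite /kap; case: pickP => [l|/(_ k)]; last by rewrite agree_glue.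
  move=> gl; congr Some; symmetry; apply: e_inj; apply/agreeP => v vn.
  by rewrite -(agreeP _ _ _ gl) // glue_new.
have kap0 i : kap i = None -> forall k, ~~ agree new i (e k).
  by rewrite /kap; case: pickP => // h _ k; rewrite h.
have kapS i k : kap i = Some k -> glue (res i) (e k) = i.
  by rewrite /kap; case: pickP => // l il [<-]; rewrite glue_res.
(* The option [kap i] is read as a boolean, so [s] is the indicator of the three slices; the default
   [ord0] occurs only where [s] is 0. *)
exists (fun i => (kap i)%:R), (fun i => (res i, odflt ord0 (kap i))), (fun=> 1),
       (fun x => glue x.1 (e x.2)).
split=> //.
- move=> u [Ku u0]; split; last by case=> x k; rewrite kapE /= !mul1r res_glue.
  apply/K'E; split.
    move=> f; case kf: (kap f) => [k|].
      apply: eq_in_ker (Ku k) => c.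
      have -> : glue c f = glue c (e k).
        by apply: glue_agree; rewrite -(kapS _ _ kf) agree_glue.
      by rewrite kapE /= mul1r res_glue.
    apply: in_ker_eq0 => c.
    suff -> : kap (glue c f) = None by rewrite mul0r.
    case kg: (kap _) => [k|//]; have /negP[] := kap0 _ kf k.
    apply/agreeP => v vn; rewrite -(glue_new c f vn) -(kapS _ _ kg).
    by rewrite glue_new.
  move=> c; rewrite (fibre_sum_supp _ e_inj).
    by rewrite -[RHS](u0 c); apply: eq_bigr => k _; rewrite kapE /= mul1r res_glue.
  move=> i h; case ki: (kap i) => [k|]; last by rewrite mul0r.
  by have /negP[] := h k; rewrite -(kapS _ _ ki) agree_glue.
- move=> w /K'E[Kw w0] sw; split; last first.
    move=> i; rewrite mul1r; case ki: (kap i) => [k|] /=.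
      by rewrite mul1r kapS.
    by rewrite mul0r sw // ki.
  split=> [k|c] /=.
    by apply: eq_in_ker (Kw (e k)) => c; rewrite mul1r.
  rewrite -[RHS](w0 c) (fibre_sum_supp _ e_inj).
    by apply: eq_bigr => k _; rewrite mul1r.
  move=> i h; apply: sw; case ki: (kap i) => [k|//].
  by have /negP[] := h k; rewrite -(kapS _ _ ki) agree_glue.
Qed.

End Kernels.

End Glue.

(** * Sums of a function on two blocks of bits *)

Section BinaryTables.

Variable N : nat.
Local Notation cube := {ffun 'I_N -> bool}.

Definition set_bit (x : cube) (i : 'I_N) (b : bool) : cube :=
  [ffun v => if v == i then b else x v].

Definition mix (A : {set 'I_N}) (x y : cube) : cube :=
  [ffun v => if v \in A then x v else y v].

Definition bit (i : 'I_N) : cube := [ffun v => v == i].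

Lemma set_bitC x i j b c : i != j ->
  set_bit (set_bit x i b) j c = set_bit (set_bit x j c) i b.
Proof.
move=> ij; apply/ffunP => v; rewrite !ffunE.
by have [->|//] := eqVneq v j; rewrite eq_sym (negbTE ij).
Qed.

Lemma set_bit_id x i : set_bit x i (x i) = x.
Proof. by apply/ffunP => v; rewrite ffunE; case: eqP => [->|]. Qed.

(** Induction on the number of bits where [x] and [y] differ, changing one of them at a time. *)
Lemma bit_invariant (T : Type) (A : {set 'I_N}) (f : cube -> T) :
  (forall i x, i \in A -> f (set_bit x i false) = f (set_bit x i true)) ->
  forall x y : cube, (forall v, v \notin A -> x v = y v) -> f x = f y.
Proof.
move=> fA x y.
have [k] := ubnP #|[set v | x v != y v]|; elim: k x => // k IH x xk xy.
have [xy0|[i]] := set_0Vmem [set v | x v != y v].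
  congr f; apply/ffunP => v; have /setP/(_ v) := xy0.
  by rewrite !inE => /negbFE/eqP.
rewrite inE => xyi.
have iA : i \in A by apply: contraNT xyi => /xy/eqP.
have fb b c : f (set_bit x i b) = f (set_bit x i c).
  by case: b; case: c => //; rewrite fA.
rewrite -[in LHS](set_bit_id x i) (fb _ (y i)); apply: IH; last first.
  by move=> v vA; rewrite ffunE; case: eqP => [->//|_]; exact: xy.
apply: leq_trans (_ : #|[set v | x v != y v]| <= k)%N; last by [].
apply: proper_card; apply/properP; split; last first.
  by exists i; rewrite !inE ?ffunE ?eqxx.
apply/subsetP => v; rewrite !inE ffunE; have [->|//] := eqVneq v i.
by rewrite eqxx.
Qed.

(** A vanishing mixed second difference: the local form of being a function of the bits in [A] plus
    a function of the other bits. *)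
Definition biadditive (A : {set 'I_N}) (u : cube -> rat) : Prop :=
  forall i j x, i \in A -> j \notin A ->
    u (set_bit (set_bit x i false) j false) - u (set_bit (set_bit x i false) j true)
    - u (set_bit (set_bit x i true) j false) + u (set_bit (set_bit x i true) j true)
    = 0.

(** The integrated form. First differences along [A] depend only on the bits in [A]; hence
    [u z - u (mix A z y)] is unchanged when bits of [z] in [A] vary, and it agrees at [x] and
    [mix A y x]. *)
Lemma biadditive_mix (A : {set 'I_N}) u x y : biadditive A u ->
  u x + u y = u (mix A x y) + u (mix A y x).
Proof.
move=> uA.
have Hi i (x1 x2 : cube) : i \in A -> (forall v, v \in A -> x1 v = x2 v) ->
    u (set_bit x1 i false) - u (set_bit x1 i true) =
    u (set_bit x2 i false) - u (set_bit x2 i true).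
  move=> iA x12.
  apply: (@bit_invariant _ (~: A)
    (fun z => u (set_bit z i false) - u (set_bit z i true)) _ x1 x2).
    move=> j z; rewrite inE => jA.
    have ij : i != j by apply: contraNneq jA => <-.
    have := uA i j z iA jA; rewrite !(set_bitC _ _ _ ij) => h; lra.
  by move=> v; rewrite inE negbK; exact: x12.
suff : u x - u (mix A x y) = u (mix A y x) - u y by move=> h; lra.
have -> : u (mix A y x) - u y = u (mix A y x) - u (mix A (mix A y x) y).
  by congr (_ - u _); apply/ffunP => v; rewrite !ffunE; case: (v \in A).
apply: (@bit_invariant _ A (fun z => u z - u (mix A z y)) _ x (mix A y x)).
  move=> i z iA.
  have mE b : mix A (set_bit z i b) y = set_bit (mix A z y) i b.
    apply/ffunP => v; rewrite !ffunE; have [->|//] := eqVneq v i.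
    by rewrite iA.
  rewrite !mE.
  suff /(Hi i z (mix A z y) iA) h : forall v, v \in A -> z v = mix A z y v by lra.
  by move=> v vA; rewrite ffunE vA.
by move=> v vA; rewrite ffunE (negbTE vA).
Qed.

(* [u = g - f] is the coboundary of a potential on a complete bipartite graph;
   thresholding the potential gives a cut whose support lies in that of [u]. *)
Lemma biadditive_signed_elim (A : {set 'I_N}) : signed_elim (biadditive A).
Proof.
move=> u uA [x0 ux0].
pose g x := u (mix A x x0).
pose f x := u x0 - u (mix A x0 x).
have uE x : u x = g x - f x.
  rewrite /g /f; have := biadditive_mix x x0 uA; lra.
(* With this threshold exactly one of [g x0] and [f x0] exceeds [t], so [x0] lies in the cut. *)
pose t := Num.min (g x0) (f x0).
exists (fun x => (t < g x)%R%:R - (t < f x)%R%:R); split.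
- move=> i j x iA jA.
  have ij : i != j by apply: contraNneq jA => <-.
  have gE z b c : g (set_bit z j b) = g (set_bit z j c).
    congr u; apply/ffunP => v; rewrite !ffunE; case: ifP => // vA.
    by case: eqP => // vj; rewrite -vj vA in jA.
  have fE z b c : f (set_bit z i b) = f (set_bit z i c).
    congr (_ - u _); apply/ffunP => v; rewrite !ffunE; case: ifP => // vA.
    by case: eqP => // vi; rewrite vi iA in vA.
  rewrite !(gE _ true false) !(set_bitC _ _ _ ij) !(fE _ true false).
  rewrite -!(set_bitC _ _ _ ij); lra.
- exists x0; move: ux0; rewrite uE subr_eq0 /t => gf.
  case: (ltgtP (g x0) (f x0)) gf => //= h _.
    by rewrite ltxx h sub0r oppr_eq0 oner_eq0.
  by rewrite ltxx h subr0 oner_eq0.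
- move=> x; apply: contraNneq; rewrite uE => /eqP; rewrite subr_eq0 => /eqP->.
  by rewrite subrr.
- move=> x; do 2 case: (t < _);
    by rewrite ?subrr ?subr0 ?sub0r ?eqxx ?normrN ?normr1.
Qed.

(** If [x] and [y] have opposite patterns (0,1) and (1,0) at [(a, b)], both mixtures of them have
    equal bits at [a] and [b], where [u] vanishes; so [u x = - u y], and one scalar determines
    [u]. *)
Lemma biadditive_diag (A : {set 'I_N}) a b u : biadditive A u -> a \in A -> b \notin A ->
  (forall x : cube, x a = x b -> u x = 0) ->
  forall x : cube, u x = u (bit b) * ((x b)%:R - (x a)%:R).
Proof.
move=> uA aA bA u0.
have ab : a != b by apply: contraNneq bA => <-.
have swap (x y : cube) : x a = y b -> y a = x b -> u x = - u y.
  move=> xy yx; apply/eqP; rewrite -addr_eq0 (biadditive_mix _ _ uA).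
  by rewrite !u0 ?addr0 // !ffunE aA (negbTE bA).
move=> x; case xb: (x b); case xa: (x a) => /=.
- by rewrite u0 ?xa // subrr mulr0.
- rewrite subr0 mulr1 (swap _ (bit a)) ?(swap (bit b) (bit a)) //;
    by rewrite !ffunE ?eqxx ?xa ?xb ?(negbTE ab) // eq_sym (negbTE ab).
- rewrite sub0r mulrN1; apply: swap; rewrite ffunE ?eqxx //.
  by rewrite xb (negbTE ab).
- by rewrite u0 ?xa // subrr mulr0.
Qed.

(** A vector supported in that of [u] is a multiple of [u], and no multiple has absolute value 1
    both where [u] is 1 and where it is -2. *)
Lemma rigid_not_signed_elim (X : finType) (K : (X -> rat) -> Prop) (u : X -> rat) x y :
  K u -> u x = 1 -> u y = -2 ->
  (forall w, K w -> (forall z, u z = 0 -> w z = 0) ->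
     exists s, forall z, w z = s * u z) ->
  ~ signed_elim K.
Proof.
move=> Ku ux uy rigid /(_ u Ku)[]; first by exists x; rewrite ux oner_eq0.
move=> w [Kw [z wz] wu w1].
have [|s wE] := rigid w Kw.
  by move=> v uv; apply/eqP; apply: contraT => /wu; rewrite uv eqxx.
have s0 : s != 0 by apply: contraNneq wz => s0; rewrite wE s0 mul0r.
have := w1 x; rewrite wE ux mulr1 => /(_ s0) s1.
have := w1 y; rewrite wE uy normrM s1 mul1r mulf_eq0 (negbTE s0) /=.
by move=> /(_ isT)/eqP.
Qed.

Lemma sum3 (F : 'I_3 -> rat) : \sum_k F k = F 0 + F 1 + F 2.
Proof.
by rewrite !big_ord_recl big_ord0 addr0 addrA; congr (F _ + F _ + F _); apply: val_inj.
Qed.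

Lemma ord3P (P : 'I_3 -> Prop) : P 0 -> P 1 -> P 2 -> forall k, P k.
Proof.
move=> P0 P1 P2 [[|[|[|//]]] h]; [move: P0|move: P1|move: P2];
  by congr P; apply: val_inj.
Qed.

Definition tri (T : Type) (a b c : T) (k : 'I_3) : T :=
  match val k with 0 => a | 1 => b | _ => c end.

Lemma biadditive_pos (A : {set 'I_N}) a b : a \in A -> b \notin A ->
  biadditive A (fun x : cube => (x b)%:R - (x a)%:R).
Proof.
move=> aA bA i j x iA jA; rewrite !ffunE.
have ij : i != j by apply: contraNneq jA => <-.
have ib : i != b by apply: contraNneq bA => <-.
have ja : j != a by apply: contraNneq jA => ->.
rewrite (eq_sym b i) (negbTE ib) (eq_sym a j) (negbTE ja).
by case: (b == j); case: (a == i); lra.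
Qed.

Lemma biadditiveD (A : {set 'I_N}) u w : biadditive A u -> biadditive A w ->
  biadditive A (fun x => u x + w x).
Proof.
move=> uA wA i j x iA jA; have := uA i j x iA jA; have := wA i j x iA jA; lra.
Qed.

Lemma biadditiveN (A : {set 'I_N}) u : biadditive A u -> biadditive A (fun x => - u x).
Proof. move=> uA i j x iA jA; have := uA i j x iA jA; lra. Qed.

Lemma triple_biadditive_not_signed_elim (A : {set 'I_N}) a1 a2 b1 b2 :
  a1 \in A -> a2 \in A -> a1 != a2 -> b1 \notin A -> b2 \notin A -> b1 != b2 ->
  ~ signed_elim (triple (biadditive A)).
Proof.
move=> a1A a2A a12 b1A b2A b12.
have neq a b : a \in A -> b \notin A -> a != b by move=> aA; apply: contraNneq => <-.
pose u (z : cube * 'I_3) : rat :=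
  tri ((z.1 b1)%:R - (z.1 a1)%:R) ((z.1 b2)%:R - (z.1 a2)%:R)
      (- (((z.1 b1)%:R - (z.1 a1)%:R) + ((z.1 b2)%:R - (z.1 a2)%:R))) z.2.
pose pt (p q r s : bool) : cube :=
  [ffun v => [|| (v == a1) && p, (v == a2) && q, (v == b1) && r | (v == b2) && s]].
have ptE p q r s : [/\ pt p q r s a1 = p, pt p q r s a2 = q, pt p q r s b1 = r &
    pt p q r s b2 = s].
  rewrite !ffunE !eqxx.
  rewrite !(eq_sym a2 a1) !(eq_sym b2 b1) (negbTE a12) (negbTE b12).
  rewrite !(eq_sym b1 a1) !(eq_sym b1 a2) !(eq_sym b2 a1) !(eq_sym b2 a2).
  do 4 rewrite (negbTE (neq _ _ _ _)) //.
  by rewrite ?orbF ?andbT.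
(* With only [b1] set, the first layer is 1; with [b1] and [b2] set, the third is -(1 + 1). *)
apply: (@rigid_not_signed_elim _ _ u (pt false false true false, 0)
                                   (pt false false true true, 2)).
- split=> [|x]; last by rewrite sum3 /u /tri /=; lra.
  apply: ord3P; rewrite /u /tri /=.
  + exact: biadditive_pos.
  + exact: biadditive_pos.
  + by apply/biadditiveN/biadditiveD; exact: biadditive_pos.
- by rewrite /u /tri /=; have [-> _ -> _] := ptE false false true false => /=; lra.
- by rewrite /u /tri /=; have [-> -> -> ->] := ptE false false true true => /=; lra.
move=> w [Kw w0] sw.
have W0 x : w (x, 0) = w (bit b1, 0) * ((x b1)%:R - (x a1)%:R).
  apply: (biadditive_diag (Kw 0)) => // y yab.
  by apply: sw; rewrite /u /tri /= yab subrr.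
have W1 x : w (x, 1) = w (bit b2, 1) * ((x b2)%:R - (x a2)%:R).
  apply: (biadditive_diag (Kw 1)) => // y yab.
  by apply: sw; rewrite /u /tri /= yab subrr.
have W2 x : w (x, 2) = - (w (x, 0) + w (x, 1)).
  by have := w0 x; rewrite sum3; lra.
(* At the point with only [a2] and [b1] set, the first two layers of [u] are 1 and -1 and the third
   is 0; this zero equates the scalars of layers 0 and 1. *)
have st : w (bit b1, 0) = w (bit b2, 1).
  have [h1 h2 h3 h4] := ptE false true true false.
  have : w (pt false true true false, 2) = 0.
    by apply: sw; rewrite /u /tri /= h1 h2 h3 h4; lra.
  by rewrite W2 W0 W1 h1 h2 h3 h4 /=; lra.
exists (w (bit b1, 0)) => -[x k]; move: k; apply: ord3P; rewrite /u /tri /=.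
- exact: W0.
- by rewrite st; exact: W1.
- by rewrite W2 W0 W1 -st; lra.
Qed.

(** The signed kernel when [v] has three values and the other vertices two. The value of [v] is the
    index [k], so the bit at [v] is a dummy; [v] carries no sign, and the last clause expresses the
    margins omitting [v] and [j]. *)
Definition three_valued (A : {set 'I_N}) (v : 'I_N) (u : cube * 'I_3 -> rat) : Prop :=
  [/\ forall k, biadditive A (fun x => u (x, k)),
      forall k x, u (set_bit x v false, k) = u (set_bit x v true, k) &
      forall j x, j \notin A ->
        \sum_(k < 3) u (set_bit x j false, k) = \sum_(k < 3) u (set_bit x j true, k)].

Lemma three_valued_not_signed_elim (A : {set 'I_N}) v a b1 b2 :
  v \in A -> a \in A -> a != v -> b1 \notin A -> b2 \notin A -> b1 != b2 ->
  ~ signed_elim (three_valued A v).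
Proof.
move=> vA aA av b1A b2A b12.
have neq c b : c \in A -> b \notin A -> c != b by move=> cA; apply: contraNneq => <-.
pose u (z : cube * 'I_3) : rat :=
  tri ((z.1 b1)%:R - (z.1 a)%:R) ((z.1 b2)%:R - (z.1 a)%:R)
      ((z.1 a)%:R - (z.1 b1)%:R - (z.1 b2)%:R) z.2.
pose pt (p r s : bool) : cube :=
  [ffun v => [|| (v == a) && p, (v == b1) && r | (v == b2) && s]].
have ptE p r s : [/\ pt p r s a = p, pt p r s b1 = r & pt p r s b2 = s].
  rewrite !ffunE !eqxx.
  rewrite !(eq_sym b2 b1) (negbTE b12) !(eq_sym b1 a) !(eq_sym b2 a).
  do 2 rewrite (negbTE (neq _ _ _ _)) //.
  by rewrite ?orbF ?andbT.
apply: (@rigid_not_signed_elim _ _ u (pt false true false, 0) (pt false true true, 2)).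
- split.
  + apply: ord3P; rewrite /u /tri /=; try exact: biadditive_pos.
    move=> i j x iA jA; rewrite !ffunE.
    rewrite (negbTE (neq _ _ aA jA)) !(eq_sym _ i) (negbTE (neq _ _ iA b1A)).
    rewrite (negbTE (neq _ _ iA b2A)).
    by case: (b1 == j); case: (b2 == j); case: (i == a); lra.
  + move=> k x; move: k; apply: ord3P; rewrite /u /tri /= !ffunE;
      by rewrite (negbTE av) !(eq_sym _ v)
                 ?(negbTE (neq _ _ vA b1A)) ?(negbTE (neq _ _ vA b2A)).
  + move=> j x jA; rewrite !sum3 /u /tri /= !ffunE (negbTE (neq _ _ aA jA)).
    by case: (b1 == j); case: (b2 == j); lra.
- by rewrite /u /tri /=; have [-> -> _] := ptE false true false => /=; lra.
- by rewrite /u /tri /=; have [-> -> ->] := ptE false true true => /=; lra.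
move=> w [Kw _ wB] sw.
have W0 x : w (x, 0) = w (bit b1, 0) * ((x b1)%:R - (x a)%:R).
  apply: (biadditive_diag (Kw 0)) => // y yab.
  by apply: sw; rewrite /u /tri /= yab subrr.
have W1 x : w (x, 1) = w (bit b2, 1) * ((x b2)%:R - (x a)%:R).
  apply: (biadditive_diag (Kw 1)) => // y yab.
  by apply: sw; rewrite /u /tri /= yab subrr.
have S (x y : cube) : (forall c, c \in A -> x c = y c) ->
    w (x, 0) + w (x, 1) + w (x, 2) = w (y, 0) + w (y, 1) + w (y, 2).
  move=> xy; rewrite -!(sum3 (fun k => w (_, k))).
  apply: (@bit_invariant _ (~: A) (fun z => \sum_k w (z, k)) _ x y).
    by move=> i z; rewrite inE; exact: wB.
  by move=> c; rewrite inE negbK; exact: xy.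
(* Setting bits [b1], [b2] of [x] to [r], [s] with [x a = r + s] makes the third layer of [u], hence
   of [w], vanish. The layer sum of [w] depends only on the bits in [A], so layers 0 and 1 determine
   layer 2. *)
have W2 (x : cube) r s : x a = (r (+) s) -> ~~ (r && s) -> w (x, 2) =
    w (bit b1, 0) * (r%:R - (x b1)%:R) + w (bit b2, 1) * (s%:R - (x b2)%:R).
  move=> xa rs.
  pose y : cube := mix A x (pt false r s).
  have ya : y a = x a by rewrite ffunE aA.
  have yb1 : y b1 = r by rewrite ffunE (negbTE b1A); have [] := ptE false r s.
  have yb2 : y b2 = s by rewrite ffunE (negbTE b2A); have [] := ptE false r s.
  have y2 : w (y, 2) = 0.
    apply: sw; rewrite /u /tri /= ya yb1 yb2 xa.
    by case: r s rs {xa y ya yb1 yb2} => -[] //= _; lra.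
  have : forall c, c \in A -> x c = y c by move=> c cA; rewrite ffunE cA.
  move=> /S; rewrite y2 (W0 x) (W0 y) (W1 x) (W1 y) ya yb1 yb2; lra.
(* When [x a = 1] both (1,0) and (0,1) are allowed for [(r, s)]; comparing the two formulas equates
   the scalars. *)
have st : w (bit b1, 0) = w (bit b2, 1).
  have [h1 h2 h3] := ptE true false false.
  have := W2 _ true false h1 isT; rewrite (W2 _ false true h1 isT) h2 h3 /=; lra.
exists (w (bit b1, 0)) => -[x k]; move: k; apply: ord3P; rewrite /u /tri /=.
- exact: W0.
- by rewrite st; exact: W1.
- rewrite (W2 x (x a) false) ?addbF ?andbF // -st /=; lra.
Qed.

End BinaryTables.

(** * The kernel of D_{m,n} *)

(** The facets of D_{m,n} are the complements of pairs across the blocks. An arbitrary [A] lets the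
    two blocks be exchanged. *)
Definition cross_ker N (A : {set 'I_N}) (d : 'I_N -> nat) (u : col_t d -> rat) :=
  forall i j, i \in A -> j \notin A -> forall c, margin (~: [set i; j]) u c = 0.

Lemma cross_kerC N (A : {set 'I_N}) (d : 'I_N -> nat) (u : col_t d -> rat) :
  cross_ker A u -> cross_ker (~: A) u.
Proof.
by move=> Ku i j; rewrite !inE negbK setUC => iA jA c; exact: Ku.
Qed.

(** A face is a set whose complement lies in neither block, so it avoids a vertex of each and is
    contained in a complement of a cross pair. *)
Lemma Dmn_kerP m n d (u : col_t d -> rat) :
  in_ker (Dmn m n) u <-> cross_ker (block1 m n) u.
Proof.
rewrite in_kerP; split=> Ku.
  move=> i j iA jA; apply: Ku; rewrite /Dmn /alex_dual in_set setCK in_set.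
  by rewrite negb_or !subUset !sub1set /block2 !in_setC iA (negbTE jA).
move=> S; rewrite /Dmn /alex_dual in_set in_set negb_or.
case/andP=> /subsetPn[j jS jA] /subsetPn[i iS iA].
apply: margin_subset (Ku i j _ jA); last by move: iA; rewrite in_setC negbK.
apply/subsetP => v vS; rewrite !inE negb_or.
by apply/andP; split; [apply: contraTneq iS => <-|apply: contraTneq jS => <-];
   rewrite inE vS.
Qed.

(** * Tables of bits inside tables with at least two values per vertex *)

Section Columns.

Variables (N : nat) (d : 'I_N -> nat).
Hypothesis hd : forall v, (2 <= d v)%N.
Local Notation cube := {ffun 'I_N -> bool}.

Definition upd (c : col_t d) (i : 'I_N) (p : nat) : col_t d :=
  [ffun v => insubd (c v) (if v == i then p else c v : nat)].

Lemma updE c i p v : (p < d i)%N -> upd c i p v = (if v == i then p else c v) :> nat.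
Proof.
by move=> pd; rewrite ffunE val_insubd; case: eqP => [->|_]; rewrite ?pd ?ltn_ord.
Qed.

Lemma col_eqP (c e : col_t d) : (forall v, c v = e v :> nat) -> c = e.
Proof. by move=> ce; apply/ffunP => v; apply: val_inj; apply: ce. Qed.

Lemma margin_pair (i j : 'I_N) (u : col_t d -> rat) c : i != j ->
  margin (~: [set i; j]) u c =
  \sum_(p < d i) \sum_(q < d j) u (upd (upd c i p) j q).
Proof.
move=> ij; rewrite pair_big /= /margin.
rewrite (reindex_onto (fun pq : 'I_(d i) * 'I_(d j) => upd (upd c i pq.1) j pq.2)
                      (fun k : col_t d => (k i, k j))) /=.
  apply: eq_bigl => -[p q] /=; apply/andP; split.
    apply/agreeP => v; rewrite !inE negb_or => /andP[/negbTE vi /negbTE vj].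
    by apply: val_inj; rewrite /= !updE ?vi ?vj ?ltn_ord.
  apply/eqP; congr pair; apply: val_inj; rewrite /= !updE ?ltn_ord ?eqxx //.
  by rewrite (negbTE ij).
move=> k /agreeP kc; apply: col_eqP => v; rewrite !updE ?ltn_ord //.
have [->//|vj] := eqVneq v j; have [->//|vi] := eqVneq v i.
by rewrite kc // !inE negb_or vi.
Qed.

Definition small (b : 'I_N -> nat) (c : col_t d) : bool := [forall v, (c v < b v)%N].

Lemma big_ord_support (m n : nat) (F : nat -> rat) : (m <= n)%N ->
  (forall p, (m <= p)%N -> F p = 0) -> \sum_(p < n) F p = \sum_(p < m) F p.
Proof.
move=> mn F0; rewrite (big_ord_widen n F mn) [LHS](bigID (fun p : 'I_n => (p < m)%N)) /=.
by rewrite [X in _ + X]big1 ?addr0 // => p; rewrite -leqNgt => /F0.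
Qed.

(** For [p < b i] and [q < b j], lying in the box depends only on the other coordinates, so this
    condition factors out of the sum. *)
Lemma margin_small (b : 'I_N -> nat) (i j : 'I_N) (G : col_t d -> rat) c :
  (forall v, 0 < b v <= d v)%N -> i != j ->
  margin (~: [set i; j]) (fun k => (small b k)%:R * G k) c =
  (small b (upd (upd c i 0) j 0))%:R *
    \sum_(p < b i) \sum_(q < b j) G (upd (upd c i p) j q).
Proof.
move=> bd ij; rewrite margin_pair //.
have b0 v : (0 < b v)%N by case/andP: (bd v).
have d0 v : (0 < d v)%N by apply: leq_trans (hd v).
have bled v : (b v <= d v)%N by case/andP: (bd v).
have out p q : (p < d i)%N -> (q < d j)%N -> (b i <= p)%N || (b j <= q)%N ->
    small b (upd (upd c i p) j q) = false.
  move=> pd qd h; apply/forallP => sm; move: h; rewrite (leqNgt _ p) (leqNgt _ q).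
  have := sm j; rewrite !updE // eqxx => ->.
  by have := sm i; rewrite !updE // (negbTE ij) eqxx => ->.
have inn p q : (p < b i)%N -> (q < b j)%N ->
    small b (upd (upd c i p) j q) = small b (upd (upd c i 0) j 0).
  move=> pb qb; apply: eq_forallb => v.
  rewrite !updE ?(leq_trans pb) ?(leq_trans qb) //.
  have [->|_] := eqVneq v j; first by rewrite qb b0.
  by have [->|_] := eqVneq v i; first by rewrite pb b0.
(* The summand extended by zero to all natural numbers, so that the ranges can be cut down to [b i]
   and [b j]. *)
pose F p q : rat :=
  if (p < d i)%N && (q < d j)%N then
    (small b (upd (upd c i p) j q))%:R * G (upd (upd c i p) j q) else 0.
have F0 p q : (b i <= p)%N || (b j <= q)%N -> F p q = 0.
  by move=> h; rewrite /F; case: ifP => // /andP[pd qd]; rewrite out ?mul0r.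
transitivity (\sum_(p < d i) \sum_(q < d j) F p q).
  by apply: eq_bigr => p _; apply: eq_bigr => q _; rewrite /F !ltn_ord.
rewrite (@big_ord_support (b i) _ (fun p => \sum_(q < d j) F p q)) //; last first.
  by move=> p bp; rewrite big1 // => q _; rewrite F0 ?bp.
rewrite mulr_sumr; apply: eq_bigr => p _.
rewrite (@big_ord_support (b j)) //; last by move=> q bq; rewrite F0 ?bq ?orbT.
rewrite mulr_sumr; apply: eq_bigr => q _.
by rewrite /F !(leq_trans (ltn_ord _)) //= inn.
Qed.

Definition bits (c : col_t d) : cube := [ffun v => c v == 1%N :> nat].

Lemma bits_upd c i p : (p < d i)%N -> bits (upd c i p) = set_bit (bits c) i (p == 1%N).
Proof.
by move=> pd; apply/ffunP => v; rewrite ffunE updE // !ffunE; case: (v == i).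
Qed.

(** It turns the plain sums of a margin into alternating ones. [Z] is the set of all vertices in the
    binary case and omits the three-valued vertex otherwise. *)
Definition sgn (Z : {set 'I_N}) (x : cube) : rat := \prod_(v in Z) (-1) ^+ x v.

Lemma normr_sgn Z x : `|sgn Z x| = 1.
Proof. by rewrite normr_prod big1 // => v _; rewrite normr_sign. Qed.

Lemma sgn_sqr Z x : sgn Z x * sgn Z x = 1.
Proof. by rewrite -big_split big1 //= => v _; rewrite -expr2 sqrr_sign. Qed.

Lemma sgn_set_bit_in (Z : {set 'I_N}) (x : cube) i : i \in Z ->
  sgn Z (set_bit x i true) = - sgn Z (set_bit x i false).
Proof.
move=> iZ; rewrite /sgn !(bigD1 i iZ) /= !ffunE eqxx expr0 mul1r expr1 mulN1r.
by congr (- _); apply: eq_bigr => v /andP[_ /negbTE vi]; rewrite !ffunE vi.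
Qed.

Lemma sgn_set_bit_notin (Z : {set 'I_N}) (x : cube) i b :
  i \notin Z -> sgn Z (set_bit x i b) = sgn Z x.
Proof.
move=> iZ; apply: eq_bigr => v vZ; rewrite ffunE.
by case: eqP => // vi; rewrite -vi vZ in iZ.
Qed.

Definition col_of (f : 'I_N -> nat) : col_t d :=
  [ffun v => insubd (Ordinal (leq_trans (leqnSn 1) (hd v))) (f v)].

Lemma col_ofE f v : (f v < d v)%N -> col_of f v = f v :> nat.
Proof. by move=> fd; rewrite ffunE val_insubd fd. Qed.

Variable A : {set 'I_N}.

Let two (v : 'I_N) := 2%N.

(** Flipping bit [i] or [j] flips the sign, so the sum over the four completions becomes the mixed
    second difference of [biadditive]. *)
Lemma margin_two (i j : 'I_N) (U : cube -> rat) c : i != j ->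
  let x := bits c in
  margin (~: [set i; j]) (fun k => (small two k)%:R * (sgn setT (bits k) * U (bits k))) c =
  (small two (upd (upd c i 0) j 0))%:R * (sgn setT (set_bit (set_bit x i false) j false) *
   (U (set_bit (set_bit x i false) j false) - U (set_bit (set_bit x i false) j true)
    - U (set_bit (set_bit x i true) j false) + U (set_bit (set_bit x i true) j true))).
Proof.
move=> ij x; rewrite margin_small //.
congr (_ * _); rewrite !big_ord_recl !big_ord0 !addr0 /=.
rewrite !bits_upd ?(leq_trans _ (hd _)) //= -/x.
rewrite !(sgn_set_bit_in _ (in_setT j)) !(set_bitC _ _ _ ij).
rewrite !(sgn_set_bit_in _ (in_setT i)); ring.
Qed.

Lemma bits_col_of (x : cube) : bits (col_of (fun v => x v)) = x.
Proof.
apply/ffunP => v; rewrite ffunE col_ofE; first by case: (x v).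
by apply: leq_trans (hd v); rewrite ltnS leq_b1.
Qed.

Lemma small_col_of (x : cube) : small two (col_of (fun v => x v)).
Proof.
apply/forallP => v; rewrite col_ofE ?ltnS ?leq_b1 //.
by apply: leq_trans (hd v); rewrite ltnS leq_b1.
Qed.

Lemma small_upd00 (b : 'I_N -> nat) c i j : (forall v, 0 < b v)%N ->
  small b c -> small b (upd (upd c i 0) j 0).
Proof.
move=> b0 /forallP sm; apply/forallP => v.
rewrite !updE ?(leq_trans _ (hd _)) //.
by case: ifP => // _; case: ifP.
Qed.

Lemma col_of_bits c : small two c -> col_of (fun v => bits c v) = c.
Proof.
move=> /forallP sm; apply: col_eqP => v; rewrite col_ofE ffunE.
  by have := sm v; case: (nat_of_ord (c v)) => [|[]].
by apply: leq_trans (hd v); rewrite ltnS leq_b1.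
Qed.

Lemma cross_ker_biadditive (u : cube -> rat) :
  biadditive A u <->
  cross_ker A (fun k : col_t d => (small two k)%:R * (sgn setT (bits k) * u (bits k))).
Proof.
have neq i j : i \in A -> j \notin A -> i != j by move=> iA; apply: contraNneq => <-.
split=> uA i j.
  by move=> iA jA c; rewrite margin_two ?neq // uA // !mulr0.
move=> x iA jA; have := uA i j iA jA (col_of (fun v => x v)).
rewrite margin_two ?neq // small_upd00 ?small_col_of // mul1r bits_col_of.
by move=> /eqP; rewrite mulf_eq0 -normr_eq0 normr_sgn oner_eq0 => /eqP.
Qed.

Lemma eq_cross_ker (u w : col_t d -> rat) : u =1 w -> cross_ker A u -> cross_ker A w.
Proof. by move=> uw Ku i j iA jA c; rewrite -(eq_margin _ _ uw) Ku. Qed.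

(** Binary tables sit on the columns with values 0 and 1, with sign, and are zero elsewhere. *)
Lemma biadditive_embeds : embeds (biadditive A) (@cross_ker N A d).
Proof.
exists (fun c => (small two c)%:R * sgn setT (bits c)), bits, (sgn setT),
       (fun x : cube => col_of (fun v => x v)).
split=> [x|u uA|w Kw sw]; first exact: normr_sgn.
  split; last by move=> x; rewrite small_col_of bits_col_of mul1r mulrA sgn_sqr mul1r.
  by apply: eq_cross_ker ((cross_ker_biadditive u).1 uA) => k; rewrite mulrA.
have wE c : w c = (small two c)%:R * sgn setT (bits c) *
    (sgn setT (bits c) * w (col_of (fun v => bits c v))).
  have [sc|nsc] := boolP (small two c).
    by rewrite mul1r mulrA sgn_sqr mul1r col_of_bits.
  by rewrite sw ?mul0r // (negbTE nsc) mul0r.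
split=> //.
by apply/cross_ker_biadditive; apply: eq_cross_ker Kw => c; rewrite [LHS]wE -mulrA.
Qed.

Lemma embeds_biadditive : (forall v, d v = 2%N) ->
  embeds (@cross_ker N A d) (biadditive A).
Proof.
move=> d2.
have sm c : small two c by apply/forallP => v; rewrite -[X in (_ < X)%N](d2 v).
exists (sgn setT), (fun x : cube => col_of (fun v => x v)),
       (fun c => sgn setT (bits c)), bits.
split=> [c|u Ku|w uA _]; first exact: normr_sgn.
  split; last by move=> x; rewrite col_of_bits // mulrA sgn_sqr mul1r.
  apply/cross_ker_biadditive; apply: eq_cross_ker Ku => c.
  by rewrite sm mul1r mulrA sgn_sqr mul1r col_of_bits.
split; last by move=> x; rewrite bits_col_of mulrA sgn_sqr mul1r.
apply: eq_cross_ker ((cross_ker_biadditive w).1 uA) => c.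
by rewrite sm mul1r.
Qed.

(** * A vertex with at least three values *)

Variable v : 'I_N.
Hypotheses (vA : v \in A) (dv : (2 < d v)%N).

Let three (w : 'I_N) := (2 + (w == v))%N.

Let three_bound w : (0 < three w <= d w)%N.
Proof. by rewrite /three; case: eqP => [->|_]; rewrite ?addn0 ?hd. Qed.

(** [inord] sends values above 2 to 0; such columns are outside the box [small three]. *)
Let level (c : col_t d) : 'I_3 := inord (c v).

Let sv := sgn [set~ v].

Let col3 (z : cube * 'I_3) : col_t d :=
  col_of (fun w => if w == v then z.2 : nat else z.1 w).

Let col3E z w : col3 z w = (if w == v then z.2 : nat else z.1 w) :> nat.
Proof.
rewrite col_ofE //; case: eqP => [->|_]; first exact: leq_trans (ltn_ord _) dv.
by apply: leq_trans (hd w); rewrite ltnS leq_b1.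
Qed.

Let small_col3 z : small three (col3 z).
Proof.
apply/forallP => w; rewrite col3E /three; case: eqP => _; first exact: ltn_ord.
by rewrite ltnS leq_b1.
Qed.

Let level_col3 z : level (col3 z) = z.2.
Proof. by rewrite /level col3E eqxx inord_val. Qed.

Let bits_col3 z b : set_bit (bits (col3 z)) v b = set_bit z.1 v b.
Proof.
apply/ffunP => w; rewrite ffunE [RHS]ffunE; case: eqP => // /eqP/negbTE wv.
by rewrite ffunE col3E wv; case: (z.1 w).
Qed.

Let col3_bits c : small three c -> col3 (bits c, level c) = c.
Proof.
move=> /forallP sm; apply: col_eqP => w; rewrite col3E /= /level.
have := sm w; rewrite /three; have [->|_] := eqVneq w v.
  by move=> h; rewrite inordK.
by rewrite ffunE; case: (nat_of_ord (c w)) => [|[]].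
Qed.

Let inv_set_bit (T : Type) (f : cube -> T) x b :
  (forall x, f (set_bit x v false) = f (set_bit x v true)) -> f (set_bit x v b) = f x.
Proof.
move=> h; rewrite -[in RHS](set_bit_id x v).
by case: b; case: (x v); rewrite ?h.
Qed.

Let cross_ker_three (u : cube * 'I_3 -> rat) :
  (forall k x, u (set_bit x v false, k) = u (set_bit x v true, k)) ->
  three_valued A v u <->
  cross_ker A (fun c => (small three c)%:R * (sv (bits c) * u (bits c, level c))).
Proof.
move=> uv.
have neq i j : i \in A -> j \notin A -> i != j by move=> iA; apply: contraNneq => <-.
have uvb k x b : u (set_bit x v b, k) = u (x, k).
  exact: (@inv_set_bit _ (fun x => u (x, k))).
have jv j : j \notin A -> j \in [set~ v].
  by move=> jA; rewrite !inE eq_sym neq.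
have jnv j : j \notin A -> j != v by move=> jA; rewrite eq_sym neq.
(* Omitting [i] other than [v] keeps the layer fixed and gives a mixed second difference in it. *)
have marg_i i j c : i \in A -> i != v -> j \notin A ->
  margin (~: [set i; j])
    (fun c => (small three c)%:R * (sv (bits c) * u (bits c, level c))) c =
  (small three (upd (upd c i 0) j 0))%:R *
    (sv (set_bit (set_bit (bits c) i false) j false) *
    (let U x := u (x, level c) in let x := bits c in
     U (set_bit (set_bit x i false) j false) - U (set_bit (set_bit x i false) j true)
    - U (set_bit (set_bit x i true) j false) + U (set_bit (set_bit x i true) j true))).
  move=> iA iv jA; rewrite margin_small ?neq //; congr (_ * _).
  have -> : three i = 2%N by rewrite /three (negbTE iv).
  have -> : three j = 2%N by rewrite /three eq_sym (negbTE (neq _ _ vA jA)).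
  have lev p q : (p < 2)%N -> (q < 2)%N -> level (upd (upd c i p) j q) = level c.
    move=> p2 q2; rewrite /level !updE ?(leq_trans _ (hd _)) //.
    by rewrite (negbTE (neq _ _ vA jA)) eq_sym (negbTE iv).
  rewrite !big_ord_recl !big_ord0 !addr0 /= !lev //.
  rewrite !bits_upd ?(leq_trans _ (hd _)) //= /sv.
  rewrite !(sgn_set_bit_in _ (jv _ jA)) !(set_bitC _ _ _ (neq _ _ iA jA)).
  have ivs : i \in [set~ v] by rewrite !inE.
  rewrite !(sgn_set_bit_in _ ivs); ring.
(* Omitting [v] adds up the three layers; only [j] contributes a sign, which leaves a difference of
   layer sums. *)
have marg_v j c : j \notin A ->
  margin (~: [set v; j])
    (fun c => (small three c)%:R * (sv (bits c) * u (bits c, level c))) c =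
  (small three (upd (upd c v 0) j 0))%:R *
    (sv (set_bit (bits c) j false) *
    (\sum_(k < 3) u (set_bit (bits c) j false, k) -
     \sum_(k < 3) u (set_bit (bits c) j true, k))).
  move=> jA; rewrite margin_small ?neq //; congr (_ * _).
  have -> : three v = 3%N by rewrite /three eqxx.
  have -> : three j = 2%N by rewrite /three eq_sym (negbTE (neq _ _ vA jA)).
  rewrite -sumrB mulr_sumr; apply: eq_bigr => p _.
  have pd : (p < d v)%N by apply: leq_trans (ltn_ord p) dv.
  have lev q : (q < 2)%N -> level (upd (upd c v p) j q) = p.
    move=> q2; rewrite /level !updE ?(leq_trans q2 (hd _)) //.
    by rewrite (negbTE (neq _ _ vA jA)) eqxx inord_val.
  rewrite !big_ord_recl !big_ord0 !addr0 /= !lev //.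
  rewrite !bits_upd ?pd ?(leq_trans _ (hd _)) //= /sv.
  have vs : v \notin [set~ v] by rewrite !inE eqxx.
  rewrite !(set_bitC _ _ _ (neq _ _ vA jA)) !uvb !(sgn_set_bit_notin _ _ vs).
  rewrite (sgn_set_bit_in _ (jv _ jA)); ring.
split=> [[uA _ uB] i j iA jA c|Ku].
  have [->|iv] := eqVneq i v; first by rewrite marg_v // uB // subrr !mulr0.
  by rewrite marg_i //= (uA (level c)) // !mulr0.
have sgn0 Z x (y : rat) : sgn Z x * y = 0 -> y = 0.
  by move=> /eqP; rewrite mulf_eq0 -normr_eq0 normr_sgn oner_eq0 => /eqP.
have three0 w : (0 < three w)%N by case/andP: (three_bound w).
split=> // [k i j x iA jA|j x jA].
  have [->|iv] := eqVneq i v.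
    by rewrite !(set_bitC _ _ _ (neq _ _ vA jA)) !uvb; ring.
  have := Ku i j iA jA (col3 (x, k)).
  rewrite marg_i // small_upd00 ?small_col3 // mul1r => /sgn0 /=.
  rewrite level_col3 /=.
  have bE b c : u (set_bit (set_bit (bits (col3 (x, k))) i b) j c, k) =
                u (set_bit (set_bit x i b) j c, k).
    rewrite -(uvb _ _ false) -[in RHS](uvb _ _ false).
    by rewrite !(set_bitC _ _ _ (jnv _ jA)) !(set_bitC _ _ _ iv) bits_col3.
  by rewrite !bE.
have := Ku v j vA jA (col3 (x, 0)).
rewrite marg_v // small_upd00 ?small_col3 // mul1r => /sgn0.
have bE k b : u (set_bit (bits (col3 (x, 0))) j b, k) = u (set_bit x j b, k).
  rewrite -(uvb _ _ false) -[in RHS](uvb _ _ false).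
  by rewrite !(set_bitC _ _ _ (jnv _ jA)) bits_col3.
by under eq_bigr do rewrite bE; under [X in _ - X]eq_bigr do rewrite bE;
  move/eqP; rewrite subr_eq0 => /eqP.
Qed.

Lemma three_valued_embeds : embeds (three_valued A v) (@cross_ker N A d).
Proof.
exists (fun c => (small three c)%:R * sv (bits c)), (fun c => (bits c, level c)),
       (fun z => sv z.1), col3.
have svb x b : sv (set_bit x v b) = sv x.
  by rewrite /sv sgn_set_bit_notin // !inE eqxx.
have sv3 z : sv (bits (col3 z)) = sv z.1.
  by rewrite -(svb _ false) bits_col3 svb.
split=> [z|u uA|w Kw sw]; first exact: normr_sgn.
  have [_ uv _] := uA; split.
    by apply: eq_cross_ker ((cross_ker_three uv).1 uA) => k; rewrite mulrA.
  case=> x k; rewrite small_col3 mul1r sv3 level_col3 /= mulrA sgn_sqr mul1r.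
  rewrite -(@inv_set_bit _ (fun y => u (y, k)) _ false) // bits_col3.
  exact: (@inv_set_bit _ (fun y => u (y, k))).
have wE c : w c = (small three c)%:R * sv (bits c) *
    (sv (bits c) * w (col3 (bits c, level c))).
  have [sc|nsc] := boolP (small three c).
    by rewrite mul1r mulrA sgn_sqr mul1r col3_bits.
  by rewrite sw ?mul0r // (negbTE nsc) mul0r.
split=> //; apply/cross_ker_three.
  move=> k x /=; rewrite !svb; congr (_ * w _).
  by apply: col_eqP => z; rewrite !col3E /= !ffunE; case: eqP.
by apply: eq_cross_ker Kw => c; rewrite [LHS]wE -mulrA.
Qed.

End Columns.

Lemma embeds_eq (X X' : finType) (K1 K2 : (X -> rat) -> Prop)
    (K1' K2' : (X' -> rat) -> Prop) :
  (forall u, K1 u <-> K2 u) -> (forall u, K1' u <-> K2' u) ->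
  embeds K1 K1' -> embeds K2 K2'.
Proof.
move=> KE KE' [s [p [t [q [t1 KK' K'K]]]]]; exists s, p, t, q; split=> //.
  by move=> u /KE/KK'[/KE' Ku tu].
by move=> w /KE' Kw /(K'K _ Kw)[/KE Kt wE].
Qed.

(** * The iterated operations *)

Lemma col_inhabited N (d : 'I_N -> nat) : (forall v, (2 <= d v)%N) -> inhabited (col_t d).
Proof. by move=> hd; constructor; exact: (col_of hd (fun=> 0%N)). Qed.

Lemma emb_new_cone N p :
  ~: (@lshift N p @: [set: 'I_N]) = [set rshift N u | u : 'I_p].
Proof.
apply/setP => v; rewrite inE; apply/idP/imsetP => [|[u _ ->]].
  case: (split_ordP v) => u -> h; last by exists u.
  by rewrite imset_f in h.
by apply/imsetP => -[w _ /eqP]; rewrite eq_rlshift.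
Qed.

Lemma widen_ord_succ_inj N : injective (@widen_ord N N.+1 (leqnSn N)).
Proof. by move=> i j /(congr1 val) /= /val_inj. Qed.

Lemma emb_new_succ N :
  ~: (@widen_ord N N.+1 (leqnSn N) @: [set: 'I_N]) = [set ord_max].
Proof.
apply/setP => v; rewrite !inE; apply/idP/eqP => [h|->].
  apply: val_inj => /=; apply/eqP; rewrite eqn_leq -ltnS ltn_ord /= leqNgt.
  apply: contra h => vN; apply/imsetP; exists (Ordinal vN) => //.
  exact: val_inj.
by apply/imsetP => -[w _ /(congr1 val) /= wN]; have := ltn_ord w; rewrite -wN ltnn.
Qed.

Lemma in_ker_cone N p (C : complex N) (d : 'I_(N + p) -> nat) (u : col_t d -> rat) :
  in_ker (cone_op p C) u <-> slices_ker (@lshift N p) C u.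
Proof.
rewrite slices_kerP; last exact: lshift_inj.
rewrite in_ker_gen emb_new_cone; split=> Ku F.
  by move=> FC; apply: Ku; apply/existsP; exists F; rewrite FC /=.
by case/existsP => G /andP[GC /eqP->]; exact: Ku.
Qed.

Lemma in_ker_G N (C : complex N) (d : 'I_N.+1 -> nat) (u : col_t d -> rat) :
  (forall v, (2 <= d v)%N) ->
  in_ker (G_op C) u <-> in_ker C (fibre_sum (emb := widen_ord (leqnSn N)) u).
Proof.
move=> /col_inhabited[e]; rewrite !in_kerP; split=> Ku S.
  move=> SC j; rewrite -[j](res_glue (@widen_ord_succ_inj N) j e) -margin_fibre.
  by apply: Ku; apply: imset_f.
by case/imsetP => T TC -> j; rewrite margin_fibre; exact: Ku.
Qed.

(** The facet [[n]] gives the vanishing fibre sums, and the facets [F] with the new vertex added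
    give the condition on slices. *)
Lemma in_ker_Lambda N (C : complex N) (d : 'I_N.+1 -> nat) (u : col_t d -> rat) :
  (forall v, (2 <= d v)%N) ->
  in_ker (Lambda_op C) u <->
  slices_ker (widen_ord (leqnSn N)) C u /\
  forall c, fibre_sum (emb := widen_ord (leqnSn N)) u c = 0.
Proof.
move=> /col_inhabited[e].
rewrite slices_kerP; last exact: widen_ord_succ_inj.
rewrite in_ker_gen emb_new_succ; split=> [Ku|[Ku u0] F].
  split=> [F FC j|c].
    apply: Ku; apply/orP; right; apply/existsP; exists F.
    by rewrite FC setUC /=.
  rewrite -[c](res_glue (@widen_ord_succ_inj N) c e) -margin_fibreT.
  by apply: Ku; rewrite eqxx.
case/orP => [/eqP->|/existsP[G /andP[GC /eqP->]]] j.
  by rewrite margin_fibreT.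
by rewrite setUC; exact: Ku.
Qed.

Section Layers.

Variables (N : nat) (d : 'I_N.+1 -> nat).
Hypothesis hd : forall v, (2 <= d v)%N.

Local Notation new := (~: (@widen_ord N N.+1 (leqnSn N) @: [set: 'I_N])).

Definition layer (k : nat) : col_t d := col_of hd (fun=> k).

Lemma agree_layer i k : (k < d ord_max)%N ->
  agree new i (layer k) = (i ord_max == k :> nat).
Proof.
move=> kd; rewrite emb_new_succ; apply/agreeP/eqP => [h|ik v].
  by rewrite h ?inE // col_ofE.
by rewrite inE => /eqP->; apply: val_inj; rewrite /= col_ofE.
Qed.

Lemma layer_inj k l : (k < d ord_max)%N -> (l < d ord_max)%N ->
  agree new (layer k) (layer l) = (k == l).
Proof. by move=> kd ld; rewrite agree_layer // col_ofE. Qed.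

End Layers.

(** * The base complex D_{m,n} *)

Section Base.

Variables m n : nat.
Hypotheses (hm : (1 <= m)%N) (hn : (1 <= n)%N).

Lemma block1_two : exists a1 a2, [/\ a1 \in block1 m n, a2 \in block1 m n & a1 != a2].
Proof.
have h0 : (0 < m + n + 2)%N by lia.
have h1 : (1 < m + n + 2)%N by lia.
by exists (Ordinal h0), (Ordinal h1); rewrite !inE.
Qed.

Lemma block2_two : exists b1 b2,
  [/\ b1 \notin block1 m n, b2 \notin block1 m n & b1 != b2].
Proof.
have h0 : (m.+1 < m + n + 2)%N by lia.
have h1 : (m.+2 < m + n + 2)%N by lia.
exists (Ordinal h0), (Ordinal h1); rewrite !inE -!ltnNge /=; split=> //.
by rewrite -val_eqE /= ltn_eqF.
Qed.

Variable d : 'I_(m + n + 2) -> nat.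
Hypothesis hd : forall v, (2 <= d v)%N.

Lemma Dmn_triple : ~ signed_elim (triple (@in_ker rat _ (Dmn m n) d)).
Proof.
have [a1 [a2 [a1A a2A a12]]] := block1_two.
have [b1 [b2 [b1A b2A b12]]] := block2_two.
move=> eD; apply: (triple_biadditive_not_signed_elim a1A a2A a12 b1A b2A b12).
apply: signed_elim_embeds eD; apply: embeds_triple.
apply: embeds_eq (biadditive_embeds hd (block1 m n)) => // u.
exact: iff_sym (Dmn_kerP u).
Qed.

(** With two values everywhere, cuts give elimination. A vertex with three values, another vertex of
    its block and two vertices of the other block give a rigid vector. *)
Lemma Dmn_signed_elim :
  signed_elim (@in_ker rat _ (Dmn m n) d) <-> forall v, d v = 2%N.
Proof.
have [a1 [a2 [a1A a2A a12]]] := block1_two.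
have [b1 [b2 [b1A b2A b12]]] := block2_two.
split=> [eD v|d2]; last first.
  apply: signed_elim_embeds (@biadditive_signed_elim _ (block1 m n)).
  apply: embeds_eq (embeds_biadditive hd (block1 m n) d2) => // u.
  exact: iff_sym (Dmn_kerP u).
apply/eqP; rewrite eqn_leq hd andbT leqNgt; apply/negP => dv.
have [vA|vA] := boolP (v \in block1 m n).
  have [a [aA av]] : exists a, a \in block1 m n /\ a != v.
    by have [av|] := eqVneq a1 v; [exists a2; rewrite -av eq_sym|exists a1].
  apply: (three_valued_not_signed_elim vA aA av b1A b2A b12).
  apply: signed_elim_embeds eD.
  apply: embeds_eq (three_valued_embeds hd vA dv) => // u.
  exact: iff_sym (Dmn_kerP u).
(* The same argument with the two blocks exchanged. *)
have vB : v \in ~: block1 m n by rewrite in_setC.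
have [b [bB bv]] : exists b, b \in ~: block1 m n /\ b != v.
  have [bv|] := eqVneq b1 v; last by exists b1; rewrite in_setC.
  by exists b2; rewrite in_setC -bv eq_sym.
have nC a : a \in block1 m n -> a \notin ~: block1 m n by rewrite in_setC negbK.
apply: (three_valued_not_signed_elim vB bB bv (nC _ a1A) (nC _ a2A) a12).
apply: signed_elim_embeds eD.
apply: embeds_eq (three_valued_embeds hd vB dv) => // u.
rewrite Dmn_kerP; split; last exact: cross_kerC.
by move/cross_kerC; rewrite setCK.
Qed.

End Base.

(** * Induction over the operations *)

Lemma in_ker_embeds_cone N p (C : complex N) (e : 'I_(N + p) -> nat) :
  (forall v, (2 <= e v)%N) ->
  embeds (@in_ker rat N C (fun v => e (lshift p v))) (@in_ker rat _ (cone_op p C) e).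
Proof.
move=> /col_inhabited[c]; apply: cone_embeds c _; first exact: lshift_inj.
exact: in_ker_cone.
Qed.

Lemma in_ker_embeds_G N (C : complex N) (e : 'I_N.+1 -> nat) :
  (forall v, (2 <= e v)%N) ->
  embeds (@in_ker rat N C (fun v => e (widen_ord (leqnSn N) v)))
         (@in_ker rat _ (G_op C) e).
Proof.
move=> he; have [c] := col_inhabited he.
apply: G_embeds c _; first exact: widen_ord_succ_inj.
by move=> u; exact: in_ker_G.
Qed.

Lemma in_ker_embeds_Lambda N (C : complex N) (e : 'I_N.+1 -> nat) :
  (forall v, (2 <= e v)%N) ->
  embeds (@in_ker rat N C (fun v => e (widen_ord (leqnSn N) v)))
         (@in_ker rat _ (Lambda_op C) e).
Proof.
move=> he; apply: (@Lambda_embeds _ _ _ _ _ _ _ _ (layer he 0) (layer he 1)).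
- exact: widen_ord_succ_inj.
- by move=> u; exact: in_ker_Lambda.
- by rewrite layer_inj // (leq_trans _ (he _)).
Qed.

(** The obstruction found for triples over D_{m,n} persists because each operation embeds the old
    kernel, hence its triples, in the new one. It rules out a third value at a Lawrence vertex. *)
Lemma built_triple m n (hm : (1 <= m)%N) (hn : (1 <= n)%N) N (C : complex N) W L :
  built m n C W L -> forall d : 'I_N -> nat, (forall v, (2 <= d v)%N) ->
  ~ signed_elim (triple (@in_ker rat N C d)).
Proof.
elim=> {N C W L} [|N p C W L _ IH|N C W L _ IH|N C W L _ IH] d hd.
- exact: Dmn_triple.
- move/(signed_elim_embeds (embeds_triple (in_ker_embeds_cone C hd))).
  by apply: IH => v.
- move/(signed_elim_embeds (embeds_triple (in_ker_embeds_G C hd))).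
  by apply: IH => v.
- move/(signed_elim_embeds (embeds_triple (in_ker_embeds_Lambda C hd))).
  by apply: IH => v.
Qed.

Lemma forall_imset (T T' : finType) (f : T -> T') (A : {set T}) (P : T' -> Prop) :
  (forall y, y \in f @: A -> P y) <-> (forall x, x \in A -> P (f x)).
Proof.
by split=> h x; [move=> xA; apply: h; apply: imset_f|case/imsetP => y /h Py ->].
Qed.

Lemma Lambda_signed_elim N (C : complex N) (d : 'I_N.+1 -> nat) :
  (forall v, (2 <= d v)%N) -> d ord_max = 2%N ->
  signed_elim (@in_ker rat N C (fun v => d (widen_ord (leqnSn N) v))) ->
  signed_elim (@in_ker rat _ (Lambda_op C) d).
Proof.
move=> hd d2; apply: signed_elim_embeds.
apply: (@Lambda2_embeds _ _ _ _ _ _ _ _ (layer hd 0) (layer hd 1)).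
- exact: widen_ord_succ_inj.
- by move=> u; exact: in_ker_Lambda.
- by rewrite layer_inj // d2.
move=> i; rewrite !agree_layer ?d2 //.
by have := ltn_ord (i ord_max); rewrite {2}d2; case: (nat_of_ord _) => [|[]].
Qed.

Lemma in_ker_embeds_Lambda3 N (C : complex N) (d : 'I_N.+1 -> nat) :
  (forall v, (2 <= d v)%N) -> (2 < d ord_max)%N ->
  embeds (triple (@in_ker rat N C (fun v => d (widen_ord (leqnSn N) v))))
         (@in_ker rat _ (Lambda_op C) d).
Proof.
move=> hd d3; apply: (@Lambda3_embeds _ _ _ _ _ _ _ _ (fun k : 'I_3 => layer hd k)).
- exact: widen_ord_succ_inj.
- by move=> u; exact: in_ker_Lambda.
move=> k l; rewrite layer_inj ?(leq_trans (ltn_ord _) d3) // => /eqP.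
exact: val_inj.
Qed.

Theorem theorem7p10 (m n : nat) (hm : (1 <= m)%N) (hn : (1 <= n)%N)
  (N : nat) (C : complex N) (W L : {set 'I_N}) (hC : built m n C W L)
  (d : 'I_N -> nat) (hd : forall v, (2 <= d v)%N) :
  unimodular C d <->
  (forall v, v \in W -> d v = 2%N) /\ (forall v, v \in L -> d v = 2%N).
Proof.
rewrite unimodularP.
elim: hC d hd => {N C W L} [|N p C W L _ IH|N C W L _ IH|N C W L hC IH] d hd.
- rewrite (Dmn_signed_elim hm hn hd); split=> [d2|[d2 _] v]; last exact: d2.
  by split=> v; rewrite ?inE.
- rewrite !forall_imset -(IH _ (fun v => hd _)); split.
    exact: signed_elim_embeds (in_ker_embeds_cone C hd).
  by apply: cone_signed_elim => [|u]; [exact: lshift_inj|exact: in_ker_cone].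
- rewrite !forall_imset -(IH _ (fun v => hd _)); split.
    exact: signed_elim_embeds (in_ker_embeds_G C hd).
  by apply: G_signed_elim => u; exact: in_ker_G.
have dL : (forall v, v \in ord_max |: emb1 L -> d v = 2%N) <->
    d ord_max = 2%N /\ forall v, v \in L -> d (widen_ord (leqnSn N) v) = 2%N.
  rewrite -(forall_imset (widen_ord (leqnSn N)) L (fun v => d v = 2%N)).
  split=> [h|[h1 h2] v]; last by rewrite in_setU1 => /orP[/eqP->|/h2].
  by split=> [|v vL]; apply: h; rewrite in_setU1 ?eqxx // vL orbT.
rewrite forall_imset dL; split=> [eL|[dW [d2 d_L]]].
  have [dW d_L] := (IH _ (fun v => hd _)).1
    (signed_elim_embeds (in_ker_embeds_Lambda C hd) eL).
  (* A third value of the new vertex would embed the triples over [C] in a kernel with signed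
     elimination, against [built_triple]. *)
  split=> //; split=> //; apply/eqP; rewrite eqn_leq hd andbT leqNgt.
  apply/negP => d3; apply: (built_triple hm hn hC (d := fun v => d (widen_ord _ v))).
    by move=> v; exact: hd.
  exact: signed_elim_embeds (in_ker_embeds_Lambda3 C hd d3) eL.
by apply: Lambda_signed_elim => //; apply/(IH _ (fun v => hd _)).
Qed.
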